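(* Let $n$ be a nonnegative integer, let $\sigma \in \mathfrak{S}_n$, and let $\lambda = (\lambda_1, \lambda_2, \dots, \lambda_l) = \mathrm{sh}(\mathsf{P}(\sigma))$. (1) $\emptyset = \underline{\mathsf{IES}}_0(\sigma) \subsetneq \underline{\mathsf{IES}}_1(\sigma) \subsetneq \cdots \subsetneq \underline{\mathsf{IES}}_l(\sigma)$. (2) Let $\mathrm{sh}(\hat{\mathsf{P}}(\sigma)) = (\alpha_1, \alpha_2, \dots, \alpha_l)$ and let $\underline{\mathsf{IES}}_l(\sigma) = \{x_1 < x_2 < \cdots < x_l\}$. Then, for each $1 \le k \le l$, $\alpha_k = \lambda_{i_k}$, where $i_k$ is the smallest index $1 \le t \le l$ such that $x_k \in \underline{\mathsf{IES}}_t(\sigma)$.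
   Context: Permutations $\sigma\in\mathfrak S_n$ are identified with the words $\sigma(1)\sigma(2)\cdots\sigma(n)$. $\mathsf{P}(\sigma)$ is the usual Robinson-Schensted (row) insertion tableau of $\sigma$; $\mathrm{sh}$ denotes the shape. Compositions. A composition $\alpha=(\alpha_1,\dots,\alpha_l)$ of $n$ is a finite sequence of positive integers with sum $n$; its length is $\ell(\alpha)=l$. Its composition diagram consists of left-justified rows with $\alpha_i$ cells in the $i$th row from the bottom; $(i,j)$ denotes the cell in the $i$th row from the bottom and the $j$th column from the left. The tableau $\hat{\mathsf P}(\sigma)$. A Young composition tableau of shape $\alpha$ is a filling $T$ of the composition diagram of $\alpha$ with positive integers such that (a) rows weakly increase from left to right; (b) the first column strictly increases from bottom to top; (c) for cells $(i,k+1),(j,k)$ with $i<j$: if $T(i,k+1)\ge T(j,k)$ then $(j,k+1)$ is a cell and $T(i,k+1)>T(j,k+1)$. The insertion $k\to T$ of a positive integer $k$ into $T$ is defined as follows. List the cells $(c_1,d_1),(c_2,d_2),\dots$ of the diagram of $T$ (before insertion) in order of decreasing column index $d$, and within a column in order of decreasing row index $c$. Set $k_0:=k$ and process $i=1,2,\dots$ in order: if $(c_i,d_i+1)$ is not a cell and $T(c_i,d_i)\le k_0$, place $k_0$ in a new cell $(c_i,d_i+1)$ and stop; if $(c_i,d_i+1)$ is a cell and $T(c_i,d_i)\le k_0<T(c_i,d_i+1)$, interchange $k_0$ with the entry in $(c_i,d_i+1)$ and continue; otherwise continue. If all cells have been processed without stopping, create a new row with a single cell containing $k_0$, positioned so that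 the first column strictly increases from bottom to top. For $\sigma\in\mathfrak S_n$, $\hat{\mathsf P}(\sigma)$ is the Young composition tableau obtained from the empty one by inserting $\sigma(1),\sigma(2),\dots,\sigma(n)$ successively. The sets $\underline{\mathsf{IES}}_k(\sigma)$. For $1\le k\le n$, a subsequence of $\sigma$ is $k$-increasing if it contains no decreasing subsequence of length $k+1$ (equivalently, it is a disjoint union of $k$ possibly empty increasing subsequences); $\mathfrak i_k(\sigma)$ is the length of a longest $k$-increasing subsequence of $\sigma$. $\mathrm{Inc}_k(\sigma)$ is the set of $k$-tuples $u=(u^{(i)})_{1\le i\le k}$ of (possibly empty) increasing subsequences of $\sigma$, pairwise having no common entries, with $\sum_i \ell(u^{(i)})=\mathfrak i_k(\sigma)$, where $\ell(\cdot)$ is the length of a sequence. $\mathsf{IES}(u)$ is the set of first entries $u^{(i)}_1$ of the nonempty $u^{(i)}$. The total order $\le_{\mathrm{set}}$ on finite subsets of $\mathbb Z_{>0}$ is: $A\le_{\mathrm{set}}B$ iff $|A|<|B|$, or $A=B$, or $|A|=|B|$ and, writing $A=\{a_1<a_2<\cdots\}$ and $B=\{b_1<b_2<\cdots\}$, there is $i$ with $a_j=b_j$ for $j<i$ and $a_i<b_i$. Define $\underline{\mathsf{IES}}_k(\sigma):=\max\{\mathsf{IES}(u)\mid u\in\mathrm{Inc}_k(\sigma)\}$ with respect to $\le_{\mathrm{set}}$, and $\underline{\mathsf{IES}}_0(\sigma):=\emptyset$. It is known that $\mathrm{sh}(\hat{\mathsf P}(\sigma))$ is a rearrangement of $\mathrm{sh}(\mathsf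 P(\sigma))$. *)

(* Defs.v *)
From HB Require Import structures.
From mathcomp Require Import all_boot all_order all_fingroup.
From mathcomp Require Import finmap.

Set Implicit Arguments.
Unset Strict Implicit.
Unset Printing Implicit Defensive.

Local Open Scope fset_scope.
Local Open Scope nat_scope.

(* 'I_n is {0, ..., n-1}, hence the shift to the letters 1, ..., n. *)
Definition word (n : nat) (s : 'S_n) : seq nat :=
  [seq (s i).+1 | i <- enum 'I_n].

(* Tableaux are sequences of rows; [shape] is the library's [map size]. *)
Definition tableau := seq (seq nat).

Fixpoint RS_insert (T : tableau) (x : nat) : tableau :=
  if T is r :: T' then
    let i := find (fun y => x < y) r in
    if i < size r then set_nth 0 r i x :: RS_insert T' (nth 0 r i)
    else rcons r x :: T'
  else [:: [:: x]].

Definition RS_tableau (w : seq nat) : tableau := foldl RS_insert [::] w.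

(* Composition tableaux: rows are listed from bottom to top, and cells (c, d)
   are numbered from 0. *)
Definition row_at (T : tableau) (c : nat) : seq nat := nth [::] T c.

Definition is_cell (T : tableau) (c d : nat) : bool := d < size (row_at T c).

Definition entry (T : tableau) (c d : nat) : nat := nth 0 (row_at T c) d.

Definition set_entry (T : tableau) (c d x : nat) : tableau :=
  set_nth [::] T c (set_nth 0 (row_at T c) d x).

(* By decreasing column, then decreasing row. *)
Definition reading_cells (T : tableau) : seq (nat * nat) :=
  let width := \max_(m <- shape T) m in
  [seq cd <- [seq (c, d) | d <- rev (iota 0 width), c <- rev (iota 0 (size T))]
  | is_cell T cd.1 cd.2].

Definition new_row (T : tableau) (x : nat) : tableau :=
  let i := find (fun r => x < head 0 r) T in
  take i T ++ [:: x] :: drop i T.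

Fixpoint YC_process (cs : seq (nat * nat)) (T : tableau) (k : nat) : tableau :=
  if cs is (c, d) :: cs' then
    if is_cell T c d.+1 then
      if entry T c d <= k < entry T c d.+1 then
        YC_process cs' (set_entry T c d.+1 k) (entry T c d.+1)
      else YC_process cs' T k
    else if entry T c d <= k then set_entry T c d.+1 k
    else YC_process cs' T k
  else new_row T k.

Definition YC_insert (T : tableau) (k : nat) : tableau :=
  YC_process (reading_cells T) T k.

Definition YC_tableau (w : seq nat) : tableau := foldl YC_insert [::] w.

(* The subsequences of w are the [mask m w], with m of the same size as w. *)
Definition k_increasing (k : nat) (s : seq nat) : bool :=
  ~~ [exists m : (size s).-tuple bool,
        sorted gtn (mask m s) && (size (mask m s) == k.+1)].

Definition max_k_increasing (k : nat) (w : seq nat) : nat :=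
  \max_(m : (size w).-tuple bool | k_increasing k (mask m w)) size (mask m w).

Definition in_Inc (k : nat) (w : seq nat) (u : k.-tuple (seq nat)) : bool :=
  [&& [forall i, subseq (tnth u i) w && sorted ltn (tnth u i)],
      [forall i, forall j, (i != j) ==> ~~ has (mem (tnth u i)) (tnth u j)]
    & \sum_(i < k) size (tnth u i) == max_k_increasing k w].

Definition IES (u : seq (seq nat)) : {fset nat} := [fset x in pmap ohead u].

Definition le_set (A B : {fset nat}) : bool :=
  let a := sort leq A in
  let b := sort leq B in
  [|| #|` A| < #|` B|,
      A == B
    | (#|` A| == #|` B|) &&
      [exists i : 'I_#|` A|,
         [forall j : 'I_#|` A|, (j < i) ==> (nth 0 a j == nth 0 b j)] &&
         (nth 0 a i < nth 0 b i)]].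

Definition max_set (A B : {fset nat}) : {fset nat} :=
  if le_set A B then B else A.

(* The maximum ranges over k-tuples of masks so as to have a finite index type.
   The default value fset0 is the least element for [le_set], so it does not
   affect the maximum. *)
Definition max_IES (k : nat) (w : seq nat) : {fset nat} :=
  if k == 0 then fset0 else
  \big[max_set/fset0]_(u : k.-tuple ((size w).-tuple bool)
      | in_Inc w [tuple of [seq mask (tval m) w | m <- u]])
    IES [seq mask (tval m) w | m <- u].

(* Main.v *)
Require Import Defs.
From HB Require Import structures.
From mathcomp Require Import all_boot all_order all_fingroup.
From mathcomp Require Import finmap zify.

(* Write T for the composition tableau of w and, for each column of T, list its
   entries in decreasing order; the concatenation of these lists, from the first
   column to the last, is Knuth equivalent to w.  An elementary Knuth move can be
   followed on k-tuples of disjoint increasing subsequences, by exchanging the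
   tails of two of them, without changing the total length and without lowering
   any first entry; so w may be replaced by the column word of T.  There, the k
   longest rows of T form an optimal tuple.  Conversely an optimal tuple meets
   each column of height h in min(k, h) letters, and the triple condition says
   that each row of T is continued greedily, upper rows first; counting, column
   by column, the letters reached from first entries at least v shows that no
   optimal tuple has more first entries at least v than the k longest rows (ties
   being broken in favor of the upper rows).  Hence max_IES k w is the set of first
   entries of these k rows.  The same Knuth invariance applied to the row word of
   the Robinson-Schensted tableau identifies its shape with the sorted row
   lengths of T. *)

Set Implicit Arguments.
Unset Strict Implicit.
Unset Printing Implicit Defensive.

Local Open Scope fset_scope.
Local Open Scope nat_scope.

(** * Colorings and Knuth moves *)

(** A tuple need not keep its first entries through a Knuth move: an exchange of tails can raise one
    of them. What survives is an inequality, color by color; since it holds for each move and for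
    its inverse, it is enough to compare maxima. The order on sets is awkward to transport, so a
    stronger relation replaces it: for every [v], a comparison of the numbers of first entries at
    least [v]. Simulation respects this relation, counting in the tableau produces it, and it
    implies [le_set]. As an empty subsequence has head 0 by default, it is counted at no threshold
    [v > 0]; the cardinality of the set of first entries is the case [v = 1]. The column word suits
    the insertion, which works column by column. The letter in hand is counted in the column that it
    tries to enter; bumping then leaves the word unchanged, and Knuth moves are needed only when the
    letter gives up a column and passes to the next one on the left. *)

Definition color_class (f : nat -> nat) (i : nat) (w : seq nat) : seq nat :=
  [seq x <- w | f x == i].

(* A k-tuple of disjoint increasing subsequences is encoded by a coloring of the
   letters; the letters of color at least [k] belong to none of them. *)
Definition valid_coloring (k : nat) (f : nat -> nat) (w : seq nat) : Prop :=
  forall i, i < k -> sorted ltn (color_class f i w).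

Definition weight (k : nat) (f : nat -> nat) (w : seq nat) : nat :=
  count (fun x => f x < k) w.

Definition simulates (k : nat) (w w' : seq nat) : Prop :=
  forall f, valid_coloring k f w ->
  exists f', [/\ valid_coloring k f' w', weight k f' w' = weight k f w
    & forall i, i < k -> head 0 (color_class f i w) <= head 0 (color_class f' i w')].

Lemma simulates_refl k w : simulates k w w.
Proof. by move=> f vf; exists f; split. Qed.

Lemma simulates_trans k w1 w2 w3 :
  simulates k w1 w2 -> simulates k w2 w3 -> simulates k w1 w3.
Proof.
move=> s12 s23 f /s12[f' [/s23[f'' [v3 e3 h3]] e2 h2]].
exists f''; split=> //; first by rewrite e3.
by move=> i ik; exact: leq_trans (h2 _ ik) (h3 _ ik).
Qed.

Lemma color_class_cat f i u v :
  color_class f i (u ++ v) = color_class f i u ++ color_class f i v.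
Proof. exact: filter_cat. Qed.

Lemma sorted_ltn_pairwise s : sorted ltn s = pairwise ltn s.
Proof. exact: (sorted_pairwise ltn_trans). Qed.

Lemma eq_in_color_class f f' i i' w :
  {in w, forall x, (f x == i) = (f' x == i')} -> color_class f i w = color_class f' i' w.
Proof. exact: eq_in_filter. Qed.

Lemma weight_cat k f u v : weight k f (u ++ v) = weight k f u + weight k f v.
Proof. exact: count_cat. Qed.

Lemma eq_in_weight k f f' w :
  {in w, forall x, (f x < k) = (f' x < k)} -> weight k f w = weight k f' w.
Proof. exact: eq_in_count. Qed.

Definition swap_color (i j c : nat) : nat :=
  if c == i then j else if c == j then i else c.

Lemma swap_color_lt k i j c : i < k -> j < k -> (swap_color i j c < k) = (c < k).
Proof.
by rewrite /swap_color; have [->|_] := eqVneq c i; last have [->|_] := eqVneq c j;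
  move=> // -> ->.
Qed.

Lemma swap_color_eq i j c e : (swap_color i j c == e) = (c == swap_color i j e).
Proof. by rewrite /swap_color; do ! case: ifP; lia. Qed.

Lemma color_class_transpose f k p q x y i : i < k ->
  (f x != f y) || (k <= f x) ->
  color_class f i (p ++ [:: x; y] ++ q) = color_class f i (p ++ [:: y; x] ++ q).
Proof.
move=> ik h; rewrite !color_class_cat; congr (_ ++ (_ ++ _)).
by rewrite /color_class /=; case: eqP; case: eqP => //; lia.
Qed.

(** The letters of a descent never share an increasing subsequence, so after sorting the descent the
    same coloring has the same classes. *)
Lemma simulates_transpose k p q x y : x > y ->
  simulates k (p ++ [:: x; y] ++ q) (p ++ [:: y; x] ++ q).
Proof.
move=> xy f vf; have h : (f x != f y) || (k <= f x).
  case: eqP => //= e; rewrite leqNgt; apply/negP => fx.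
  move: (vf _ fx); rewrite !color_class_cat sorted_ltn_pairwise.
  rewrite !pairwise_cat => /and3P[_ _ /and3P[_ + _]].
  by rewrite /color_class /= -e !eqxx /= andbT; lia.
exists f; split=> [i ik||i ik].
- by rewrite -(color_class_transpose p q ik h); apply: vf.
- by rewrite !weight_cat /weight /=; lia.
- by rewrite -(color_class_transpose p q ik h).
Qed.

(* For words [p ++ m ++ q]: exchanging two colors on [q] exchanges the tails of two
   increasing subsequences. *)
Definition recolor (f g : nat -> nat) (i j : nat) (p m : seq nat) (x : nat) : nat :=
  if x \in p then f x else if x \in m then g x else swap_color i j (f x).

Lemma color_class_recolor f g i j p m m' q e :
  uniq (p ++ m ++ q) -> perm_eq m m' ->
  color_class (recolor f g i j p m) e (p ++ m' ++ q) =
  color_class f e p ++ color_class g e m' ++ color_class f (swap_color i j e) q.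
Proof.
rewrite cat_uniq has_cat negb_or => /and3P[_ /andP[pm pq]].
rewrite cat_uniq => /and3P[_ mq _] mm'.
rewrite !color_class_cat; congr (_ ++ (_ ++ _)); apply: eq_in_color_class => x xin.
- by rewrite /recolor xin.
- have xm : x \in m by rewrite (perm_mem mm').
  by rewrite /recolor xm (negbTE (hasPn pm _ xm)).
- by rewrite /recolor (negbTE (hasPn pq _ xin)) (negbTE (hasPn mq _ xin)) swap_color_eq.
Qed.

Lemma weight_recolor k f g i j p m m' q : i < k -> j < k ->
  uniq (p ++ m ++ q) -> perm_eq m m' ->
  weight k (recolor f g i j p m) (p ++ m' ++ q) =
  weight k f p + weight k g m' + weight k f q.
Proof.
move=> ik jk; rewrite cat_uniq has_cat negb_or => /and3P[_ /andP[pm pq]].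
rewrite cat_uniq => /and3P[_ mq _] mm'.
rewrite !weight_cat addnA; congr (_ + _ + _); apply: eq_in_weight => x xin.
- by rewrite /recolor xin.
- have xm : x \in m by rewrite (perm_mem mm').
  by rewrite /recolor xm (negbTE (hasPn pm _ xm)).
- rewrite /recolor (negbTE (hasPn pq _ xin)) (negbTE (hasPn mq _ xin)).
  exact: swap_color_lt.
Qed.

Lemma sorted_rcons_le p (x y : nat) : x <= y ->
  sorted ltn (rcons p x) -> sorted ltn (rcons p y).
Proof.
rewrite -!cats1 => xy; case: p => [//|z p]; rewrite /= !cat_path /= !andbT.
by case/andP=> -> /= h; exact: leq_trans h xy.
Qed.

Lemma path_ltn_le (x y : nat) s : x <= y -> path ltn y s -> path ltn x s.
Proof.
move=> xy; case: s => [//|z s] /= /andP[yz ->].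
by rewrite (leq_ltn_trans xy yz).
Qed.

Lemma head_cat_le p s s' : head 0 s <= head 0 s' -> head 0 (p ++ s) <= head 0 (p ++ s').
Proof. by case: p. Qed.

(* If [a] and [c] belong to the same subsequence, it exchanges its tail with the one
   of [b], or takes [b] instead of [a] if [b] is free. *)
Lemma simulates_bac k p q a b c : a < b -> b < c ->
  uniq (p ++ [:: b; a; c] ++ q) ->
  simulates k (p ++ [:: b; a; c] ++ q) (p ++ [:: b; c; a] ++ q).
Proof.
move=> ab bc un f vf.
have [h|] := boolP ((f a != f c) || (k <= f a)).
  exists f; have e i : i < k -> color_class f i (p ++ [:: b; a; c] ++ q) =
      color_class f i (p ++ [:: b; c; a] ++ q).
    by move=> ik; have := color_class_transpose (rcons p b) q ik h; rewrite !cat_rcons.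
  split=> [i ik||i ik]; first by rewrite -e //; apply: vf.
    by rewrite !weight_cat /weight /=; lia.
  by rewrite -e.
rewrite negb_or negbK -ltnNge => /andP[/eqP eac fak].
have mm' : perm_eq [:: b; a; c] [:: b; c; a].
  by rewrite perm_cons; apply/seq.permP => x /=; lia.
have [nab nac nbc] : [/\ b == a = false, c == a = false & c == b = false] by split; lia.
case: (ltnP (f b) k) => fb; last first.
  pose g x := if x == a then f b else if x == b then f a else f x.
  exists (recolor f g (f a) (f a) p [:: b; a; c]).
  split=> [i ik||i ik].
  - rewrite color_class_recolor //.
    have -> : swap_color (f a) (f a) i = i by rewrite /swap_color; case: eqP.
    move: (vf _ ik); rewrite !color_class_cat /color_class /= /g !eqxx nac nbc nab -eac.
    have [<-|nai] := eqVneq (f a) i; last by rewrite (gtn_eqF (leq_trans ik fb)).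
    rewrite (gtn_eqF (leq_trans fak fb)) /= !sorted_cat_cons /= => /and3P[s1 s2 s3].
    by rewrite bc s3 (sorted_rcons_le (ltnW ab)).
  - rewrite weight_recolor // !weight_cat /weight /= /g !eqxx nac nbc nab; lia.
  - rewrite color_class_recolor // !color_class_cat {2 5}/color_class /= /g !eqxx.
    rewrite nac nbc nab -eac.
    have [<-|nai] := eqVneq (f a) i.
      rewrite (gtn_eqF (leq_trans fak fb)) /=; apply: head_cat_le => /=; exact: ltnW.
    by rewrite (gtn_eqF (leq_trans ik fb)) /swap_color eq_sym (negbTE nai).
have nfba : f b == f a = false.
  rewrite eq_sym.
  apply/negP => /eqP fab.
  move: (vf _ fak); rewrite !color_class_cat {2}/color_class /= -eac -fab !eqxx /=.
  by rewrite sorted_cat_cons /= ltnNge (ltnW ab) /= andbF.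
have nfab : f a == f b = false by rewrite eq_sym.
pose g x := if x == c then f b else f x.
exists (recolor f g (f a) (f b) p [:: b; a; c]).
split=> [i ik||i ik].
- rewrite color_class_recolor //.
  have := vf _ fak; have := vf _ fb; have := vf _ ik.
  rewrite !color_class_cat /color_class /g /= (eq_sym a) (eq_sym b) nac nbc -eac.
  rewrite !eqxx nfba nfab /= /swap_color.
  have [->|nai] := eqVneq i (f a).
    rewrite ?nfab ?nfba /= !sorted_cat_cons /=.
    move=> /and3P[sa1 _ _] /andP[_ sb2] _.
    by rewrite sa1 (path_ltn_le (ltnW ab)).
  have [->|nbi] := eqVneq i (f b).
    rewrite !sorted_cat_cons /=.
    move=> _ /andP[sb1 sb2] /and3P[sa1 sa2 sa3].
    by rewrite sb1 bc.
  by [].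
- rewrite weight_recolor // !weight_cat /weight /g /=.
  by rewrite (eq_sym a) (eq_sym b) nac nbc eqxx; lia.
- rewrite color_class_recolor // !color_class_cat /swap_color.
  rewrite /color_class /g /= (eq_sym a) (eq_sym b) nac nbc eqxx -eac !(eq_sym _ i).
  have [->|nai] := eqVneq i (f a); first by rewrite nfab; apply: head_cat_le.
  have [->|nbi] := eqVneq i (f b); first by apply: head_cat_le.
  by [].
Qed.

(** Only the case where [a] and [c] share a class needs work, and [b] supplies a substitute for the
    lost ascent from [a] to [c]. A first entry changes only if it was [b], and it then becomes [c],
    which is larger. *)
Lemma simulates_acb k p q a b c : a < b -> b < c ->
  uniq (p ++ [:: a; c; b] ++ q) ->
  simulates k (p ++ [:: a; c; b] ++ q) (p ++ [:: c; a; b] ++ q).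
Proof.
move=> ab bc un f vf.
have [h|] := boolP ((f a != f c) || (k <= f a)).
  exists f; have e i : i < k -> color_class f i (p ++ [:: a; c; b] ++ q) =
      color_class f i (p ++ [:: c; a; b] ++ q).
    by move=> ik; exact: (color_class_transpose p (b :: q) ik h).
  split=> [i ik||i ik]; first by rewrite -e //; apply: vf.
    by rewrite !weight_cat /weight /=; lia.
  by rewrite -e.
rewrite negb_or negbK -ltnNge => /andP[/eqP eac fak].
have mm' : perm_eq [:: a; c; b] [:: c; a; b].
  by apply/seq.permP => x /=; lia.
have [nab nac nbc] : [/\ b == a = false, c == a = false & b == c = false] by split; lia.
case: (ltnP (f b) k) => fb; last first.
  (* Here [b] is free: it follows [a] in place of [c], and [c] becomes free. *)
  pose g x := if x == c then f b else if x == b then f a else f x.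
  exists (recolor f g (f a) (f a) p [:: a; c; b]).
  split=> [i ik||i ik].
  - rewrite color_class_recolor //.
    have -> : swap_color (f a) (f a) i = i by rewrite /swap_color; case: eqP.
    move: (vf _ ik); rewrite !color_class_cat /color_class /= /g !eqxx.
    rewrite (eq_sym a) nac nbc (eq_sym a) nab -eac.
    have [<-|nai] := eqVneq (f a) i; last by rewrite (gtn_eqF (leq_trans ik fb)).
    rewrite (gtn_eqF (leq_trans fak fb)) /= !sorted_cat_cons /= => /and3P[-> s2 s3].
    by rewrite ab (path_ltn_le (ltnW bc)).
  - rewrite weight_recolor // !weight_cat /weight /= /g !eqxx.
    rewrite (eq_sym a) nac nbc (eq_sym a) nab; lia.
  - rewrite color_class_recolor // !color_class_cat /color_class /= /g !eqxx.
    rewrite (eq_sym a) nac nbc (eq_sym a) nab -eac.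
    have [<-|nai] := eqVneq (f a) i.
      by rewrite (gtn_eqF (leq_trans fak fb)) /=; apply: head_cat_le.
    by rewrite (gtn_eqF (leq_trans ik fb)) /swap_color eq_sym (negbTE nai).
have nfba : f b == f a = false.
  rewrite eq_sym.
  apply/negP => /eqP fab.
  move: (vf _ fak); rewrite !color_class_cat {2}/color_class /= -eac -fab !eqxx /=.
  by rewrite sorted_cat_cons /= (ltnNge c b) (ltnW bc) /= !andbF.
have nfab : f a == f b = false by rewrite eq_sym.
(* Now [a] is followed by [b] and the tail of [b], while [c] replaces [b] in the other class and
   keeps its own tail. *)
pose g x := if x == c then f b else f a.
exists (recolor f g (f a) (f b) p [:: a; c; b]).
split=> [i ik||i ik].
- rewrite color_class_recolor //.
  have := vf _ fak; have := vf _ fb; have := vf _ ik.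
  rewrite !color_class_cat /color_class /g /= -eac (eq_sym a) nac nbc.
  rewrite !eqxx nfab nfba /= /swap_color.
  have [->|nai] := eqVneq i (f a).
    rewrite ?eqxx ?nfba ?nfab ?nfba /= !sorted_cat_cons /=.
    move=> _ /andP[sb1 sb2] /andP[-> _].
    by rewrite ab.
  have [->|nbi] := eqVneq i (f b).
    rewrite ?eqxx ?nfba ?nfab /= !sorted_cat_cons.
    move=> _ /andP[sb1 sb2] /and3P[sa1 sa2 sa3].
    by rewrite (sorted_rcons_le (ltnW bc)).
  by [].
- by rewrite weight_recolor // !weight_cat /weight /g /= (eq_sym a) nac nbc eqxx; lia.
- rewrite color_class_recolor // !color_class_cat /swap_color.
  rewrite /color_class /g /= -eac !(eq_sym _ i) (eq_sym a) nac nbc eqxx.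
  have [->|nai] := eqVneq i (f a); first by rewrite nfab; apply: head_cat_le.
  have [->|nbi] := eqVneq i (f b); first by apply: head_cat_le; exact: ltnW.
  by [].
Qed.

(** The plactic relations with strict inequalities, as suits words with distinct letters. Symmetry
    is a constructor, so every induction over this relation has to treat both directions of a
    move. *)
Inductive knuth : seq nat -> seq nat -> Prop :=
| knuth_refl u : knuth u u
| knuth_sym u v : knuth u v -> knuth v u
| knuth_trans u v w : knuth u v -> knuth v w -> knuth u w
| knuth_bac p q a b c : a < b -> b < c ->
    knuth (p ++ [:: b; a; c] ++ q) (p ++ [:: b; c; a] ++ q)
| knuth_acb p q a b c : a < b -> b < c ->
    knuth (p ++ [:: a; c; b] ++ q) (p ++ [:: c; a; b] ++ q).

Lemma knuth_cat p q u v : knuth u v -> knuth (p ++ u ++ q) (p ++ v ++ q).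
Proof.
elim=> {u v} [u|u v _ IH|u v w _ IH1 _ IH2|p' q' a b c ab bc|p' q' a b c ab bc].
- exact: knuth_refl.
- exact: knuth_sym.
- exact: knuth_trans IH1 IH2.
- by rewrite -!catA !(catA p); apply: knuth_bac.
- by rewrite -!catA !(catA p); apply: knuth_acb.
Qed.

Lemma knuth_perm u v : knuth u v -> perm_eq u v.
Proof.
elim=> {u v} [//|u v _ IH|u v w _ IH1 _ IH2|p q a b c _ _|p q a b c _ _].
- by rewrite perm_sym.
- exact: perm_trans IH1 IH2.
- by rewrite perm_cat2l perm_cat2r; apply/seq.permP => x /=; lia.
- by rewrite perm_cat2l perm_cat2r; apply/seq.permP => x /=; lia.
Qed.

(** Each move exchanges [a] and [c]. Removing the descent keeps the coloring; only creating it
    requires an exchange of tails. *)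
Lemma knuth_simulates k u v : knuth u v -> uniq u -> simulates k u v /\ simulates k v u.
Proof.
elim=> {u v} [u|u v kuv IH|u v w kuv IH1 _ IH2|p q a b c ab bc|p q a b c ab bc] un.
- by split; exact: simulates_refl.
- by rewrite -(perm_uniq (knuth_perm kuv)) in un; have [] := IH un.
- have [s1 s2] := IH1 un.
  rewrite (perm_uniq (knuth_perm kuv)) in un; have [s3 s4] := IH2 un.
  by split; [exact: simulates_trans s1 s3|exact: simulates_trans s4 s2].
- split; first exact: simulates_bac.
  by have := @simulates_transpose k (rcons p b) q c a (ltn_trans ab bc); rewrite !cat_rcons.
- split; first exact: simulates_acb.
  exact: (@simulates_transpose k p (b :: q) c a (ltn_trans ab bc)).
Qed.

(** * Robinson-Schensted insertion *)

Lemma knuth_catl p u v : knuth u v -> knuth (p ++ u) (p ++ v).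
Proof. by move/(knuth_cat p [::]); rewrite !cats0. Qed.

Lemma knuth_catr q u v : knuth u v -> knuth (u ++ q) (v ++ q).
Proof. by move/(knuth_cat [::] q). Qed.

Fixpoint row_word (T : tableau) : seq nat :=
  if T is r :: T' then row_word T' ++ r else [::].

(** The letter [x] travels left through [s]; the letter to the left of the exchanged pair plays the
    part of [b] in the relation. *)
Lemma knuth_bump_right (x y : nat) s : x < y -> path ltn y s ->
  knuth (y :: rcons s x) (y :: x :: s).
Proof.
move=> xy; elim: s y xy => [|z s IH] y xy /=; first by move=> _; exact: knuth_refl.
case/andP=> yz zs; apply: (knuth_trans (v := [:: y, z, x & s])).
  exact: (knuth_catl [:: y]) (IH _ (ltn_trans xy yz) zs).
apply: knuth_sym; exact: (@knuth_bac [::] s).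
Qed.

(** The letter [y] travels left through [s]; the letter to the right of the exchanged pair plays the
    part of [b] in the relation. *)
Lemma knuth_bump_left (x y : nat) s : x < y -> sorted ltn (rcons s x) ->
  knuth (s ++ [:: y; x]) (y :: rcons s x).
Proof.
move=> xy; elim/last_ind: s x xy => [|s z IH] x xy; first by move=> _; exact: knuth_refl.
rewrite -cats1 cat_rcons sorted_cat_cons /= andbT => /andP[sz zx].
apply: (knuth_trans (v := s ++ [:: y; z; x])).
  by rewrite cat_rcons; apply: knuth_catl; apply: (@knuth_acb [::] [::]).
have /(knuth_catr [:: x]) := IH z (ltn_trans zx xy) sz.
by rewrite -catA /= cat_rcons.
Qed.

(** Row bumping in two journeys: [x] moves left until it stands just after the bumped letter, which
    then moves left to the front. *)
Lemma knuth_row_bump r (x : nat) : let i := find (fun y => x < y) r in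
  sorted ltn r -> x \notin r -> i < size r ->
  knuth (rcons r x) (nth 0 r i :: set_nth 0 r i x).
Proof.
move=> i sr xr ir; rewrite set_nthE ir -{1}(cat_take_drop i r) (drop_nth 0) //.
have xy : x < nth 0 r i by apply: (@nth_find _ 0 (fun y => x < y)); rewrite has_find.
move: sr; rewrite -{1}(cat_take_drop i r) (drop_nth 0) // sorted_cat_cons => /andP[s1 s2].
apply: (knuth_trans (v := take i r ++ [:: nth 0 r i, x & drop i.+1 r])).
  by rewrite rcons_cat; apply: knuth_catl; exact: knuth_bump_right.
have /(knuth_catr (drop i.+1 r)) : knuth (take i r ++ [:: nth 0 r i; x])
   (nth 0 r i :: rcons (take i r) x).
  apply: knuth_bump_left => //.
  rewrite sorted_ltn_pairwise -cats1 pairwise_cat allrel_consr allrel0r /= andbT.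
  rewrite -sorted_ltn_pairwise. rewrite andbT; apply/andP; split.
  - apply/allP => z zt; have zi : index z (take i r) < i.
      by rewrite -[X in _ < X](size_takel (ltnW ir)) index_mem.
    have := @before_find _ 0 (fun y => x < y) r _ zi.
    rewrite -(nth_take _ zi) nth_index //.
    rewrite ltnNge => /negbFE; rewrite leq_eqVlt => /orP[/eqP zx|//].
    by move: xr; rewrite -zx (mem_take zt).
  - move: s1; rewrite !sorted_ltn_pairwise -cats1 pairwise_cat; by case/and3P.
by rewrite -catA /= cat_rcons.
Qed.

Definition row_dominates (r r' : seq nat) : Prop :=
  size r' <= size r /\ forall j, j < size r' -> nth 0 r j < nth 0 r' j.

Fixpoint standard (T : tableau) : Prop :=
  if T is r :: T' then
    [/\ sorted ltn r, 0 < size r, row_dominates r (head [::] T') & standard T']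
  else True.

Lemma sorted_ltn_nthP s :
  (forall i j, i < j -> j < size s -> nth 0 s i < nth 0 s j) <-> sorted ltn s.
Proof.
split=> [h|h i j ij js]; first by apply/(sortedP 0) => i; apply: h.
by apply: (sorted_ltn_nth ltn_trans) => //; rewrite inE (ltn_trans ij).
Qed.

Lemma bump_leq r x j : j < size r -> x < nth 0 r j -> find (fun y => x < y) r <= j.
Proof. by move=> jr xj; rewrite leqNgt; apply/negP => /(before_find 0); rewrite xj. Qed.

Lemma nth_bump r x j : x \notin r -> j < find (fun y => x < y) r -> nth 0 r j < x.
Proof.
move=> xr ji; have jr : j < size r by apply: leq_trans ji (find_size _ _).
rewrite ltn_neqAle leqNgt (before_find 0 ji) andbT.
by apply: contraNneq xr => <-; exact: mem_nth.
Qed.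

Lemma sorted_bump r x : let i := find (fun y => x < y) r in
  sorted ltn r -> x \notin r -> sorted ltn (set_nth 0 r i x).
Proof.
move=> i /sorted_ltn_nthP sr xr; apply/sorted_ltn_nthP => a b ab.
have ir : i <= size r by exact: find_size.
rewrite size_set_nth !nth_set_nth /= => br.
have [ea|na] := eqVneq a i.
  rewrite (gtn_eqF (_ : i < b)); last by rewrite -ea.
  have br' : b < size r by lia.
  apply: ltn_trans (sr i b _ br'); last by lia.
  by apply: (@nth_find _ 0 (fun y => x < y)); rewrite has_find; lia.
have [eb|nb] := eqVneq b i; first by apply: nth_bump => //; lia.
by apply: sr => //; lia.
Qed.

Lemma set_nth_size (r : seq nat) x : set_nth 0 r (size r) x = rcons r x.
Proof. by elim: r => //= y r ->. Qed.

(** The bumped letter lands weakly to the left of the cell it leaves: the entry of [r] in column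
    [i0], if any, already exceeds it. There it faces [z] or an earlier entry of [r0], both
    smaller. *)
Lemma row_dominates_bump r0 r i0 z : sorted ltn r0 -> row_dominates r0 r ->
  i0 < size r0 -> nth 0 r0 i0 \notin r -> z < nth 0 r0 i0 ->
  row_dominates (set_nth 0 r0 i0 z)
    (set_nth 0 r (find (fun y => nth 0 r0 i0 < y) r) (nth 0 r0 i0)).
Proof.
set x := nth 0 r0 i0; set i := find _ r.
move=> /sorted_ltn_nthP s0 [sz dm] i0r xr zx.
have ii0 : i <= i0.
  case: (ltnP i0 (size r)) => h; last by apply: leq_trans h; exact: find_size.
  by apply: bump_leq => //; exact: dm.
have ir : i <= size r by exact: find_size.
split=> [|j]; first by rewrite !size_set_nth; lia.
rewrite !size_set_nth !nth_set_nth /= => js.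
have [ej|nj] := eqVneq j i0; have [ej'|nj'] := eqVneq j i => //.
- by apply: ltn_trans zx _; rewrite ej; apply: dm; lia.
- by apply: s0; lia.
- by apply: dm; lia.
Qed.

Lemma RS_insert_cons r T x : RS_insert (r :: T) x =
  set_nth 0 r (find (fun y => x < y) r) x ::
  if find (fun y => x < y) r < size r
  then RS_insert T (nth 0 r (find (fun y => x < y) r)) else T.
Proof.
rewrite /=; case: ltnP => // h; congr (_ :: _).
by rewrite -set_nth_size; congr (set_nth 0 r _ x); apply/eqP; rewrite eqn_leq h find_size.
Qed.

(** The third clause serves the induction: [r0] stands for the row preceding [T], from which [z] has
    just bumped [x]. *)
Lemma RS_insert_spec T x : standard T -> uniq (x :: flatten T) ->
  [/\ standard (RS_insert T x),
     knuth (row_word (RS_insert T x)) (rcons (row_word T) x)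
   & forall r0 i0 z, sorted ltn r0 -> row_dominates r0 (head [::] T) ->
     i0 < size r0 -> nth 0 r0 i0 = x -> z < x ->
     row_dominates (set_nth 0 r0 i0 z) (head [::] (RS_insert T x))].
Proof.
elim: T x => [|r T IH] x.
  move=> _ _; split=> //; first exact: knuth_refl.
  move=> r0 i0 z s0 _ i0r e zx.
  by have := @row_dominates_bump r0 [::] i0 z s0; rewrite e; apply.
rewrite RS_insert_cons; set i := find _ r; set T2 := if _ then _ else _.
move=> /= [sr r0 dm sT]; rewrite mem_cat negb_or cat_uniq => /andP[/andP[xr xT]].
move=> /and3P[ur urT uT].
split.
- rewrite /= sorted_bump // size_set_nth.
  rewrite /T2; case: (ltnP i (size r)) => ir.
    have yr := mem_nth 0 ir.
    have uy : uniq (nth 0 r i :: flatten T).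
      by rewrite /= uT andbT; apply/negP => /(hasPn urT); rewrite /= yr.
    have [sT2 _ d2] := IH _ sT uy.
    split=> //; first by lia.
    by apply: d2 => //; apply: (@nth_find _ 0 (fun y => x < y)); rewrite has_find.
  have ei : i = size r by apply/eqP; rewrite eqn_leq ir find_size.
  split=> //; first by lia.
  case: dm => d1 d2; split=> [|j js]; first by rewrite size_set_nth; lia.
  by rewrite nth_set_nth /=; case: eqP => [e|_]; [lia|exact: d2].
- rewrite /T2; case: (ltnP i (size r)) => ir; last first.
    have ei : i = size r by apply/eqP; rewrite eqn_leq ir find_size.
    by rewrite /= ei set_nth_size rcons_cat; exact: knuth_refl.
  have yr := mem_nth 0 ir.
  have uy : uniq (nth 0 r i :: flatten T).
    by rewrite /= uT andbT; apply/negP => /(hasPn urT); rewrite /= yr.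
  have [_ k2 _] := IH _ sT uy.
  apply: knuth_trans (knuth_catr _ k2) _.
  rewrite -cats1 -catA rcons_cat; apply: knuth_catl.
  by apply: knuth_sym; exact: knuth_row_bump.
- move=> r1 i1 z s1 d1 i1r e zx.
  by have := @row_dominates_bump r1 r i1 z s1; rewrite e; apply.
Qed.

Lemma perm_row_word T : perm_eq (row_word T) (flatten T).
Proof. by elim: T => //= r T IH; rewrite perm_catC perm_cat2l. Qed.

Lemma RS_tableau_spec w : uniq w ->
  standard (RS_tableau w) /\ knuth (row_word (RS_tableau w)) w.
Proof.
elim/last_ind: w => [|w x IH]; first by split=> //; exact: knuth_refl.
rewrite rcons_uniq => /andP[xw uw]; have [sT kT] := IH uw.
rewrite /RS_tableau foldl_rcons -/(RS_tableau w).
have pT : perm_eq (flatten (RS_tableau w)) w.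
  by rewrite -(permPl (perm_row_word _)) knuth_perm.
have [|sT' kT' _] := @RS_insert_spec (RS_tableau w) x sT.
  by rewrite /= (perm_mem pT) xw (perm_uniq pT).
split=> //; apply: knuth_trans kT' _; rewrite -!cats1; exact: knuth_catr.
Qed.

(** * Two columns *)

(** To pass a letter of [D], the small letter [a] uses the letter after it, which lies between the
    two. *)
Lemma knuth_column_right (a b : nat) D : pairwise gtn D -> all (ltn b) D -> a < b ->
  knuth (a :: D ++ [:: b]) (D ++ [:: a; b]).
Proof.
move=> + + ab; elim: D => [|d D IH] /=; first by move=> *; exact: knuth_refl.
move=> /andP[dD sD] /andP[bd bD].
apply: knuth_trans (knuth_catl [:: d] (IH sD bD)) => /=.
case: D bD dD {IH sD} => [|e D] /=; first by move=> _ _; exact: (@knuth_acb [::] [::]).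
by move=> /andP[be _] /andP[de _]; apply: (@knuth_acb [::]) => //; exact: ltn_trans be.
Qed.

(** To pass a letter of [D], the large letter [c] uses the letter before it, which lies between the
    two. *)
Lemma knuth_column_left (b c : nat) D : pairwise gtn D -> all (gtn b) D -> b < c ->
  knuth (b :: D ++ [:: c]) (b :: c :: D).
Proof.
move=> + + bc; elim/last_ind: D => [|D d IH] /=; first by move=> *; exact: knuth_refl.
rewrite -cats1 pairwise_cat all_cat allrel_consr allrel0r /= !andbT.
move=> /andP[dD sD] /andP[bD db].
apply: knuth_trans (knuth_catr [:: d] (IH sD bD)); rewrite /= -!catA /=.
case/lastP: D dD bD {IH sD} => [|D e] /=.
  by move=> _ _; exact: (@knuth_bac [::] [::]).
rewrite !all_rcons !cat_rcons => /andP[de _] /andP[be _].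
by apply: (@knuth_bac (b :: D) [::]) => //; exact: ltn_trans bc.
Qed.

(* In the next two lemmas a pair of [P] consists of a letter of the first
   column and a larger letter next to it in the second column. *)
Lemma knuth_columns_low (P : seq (nat * nat)) D :
  all (fun p => p.1 < p.2) P -> pairwise gtn (D ++ unzip2 P) ->
  knuth (unzip1 P ++ D ++ unzip2 P) (D ++ unzip1 P ++ unzip2 P).
Proof.
elim/last_ind: P => [|P [a b] IH]; first by move=> *; rewrite cats0; exact: knuth_refl.
rewrite all_rcons /= => /andP[ab aP].
rewrite /unzip1 /unzip2 !map_rcons -!cats1 catA pairwise_cat allrel_consr allrel0r !andbT.
rewrite -/(unzip1 P) -/(unzip2 P) => /andP[].
rewrite /= all_cat => /andP[bD bP] sD.
have sP : pairwise gtn (unzip2 P) by move: sD; rewrite pairwise_cat; case/and3P.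
apply: (knuth_trans (v := unzip1 P ++ (D ++ unzip2 P) ++ [:: a; b])).
  rewrite -!catA; apply: knuth_catl; rewrite !catA; apply: knuth_column_right => //.
  by rewrite all_cat; apply/andP.
apply: (knuth_trans (v := D ++ unzip1 P ++ unzip2 P ++ [:: a; b])).
  by have := knuth_catr [:: a; b] (IH aP sD); rewrite -!catA.
rewrite -!catA; do 2 apply: knuth_catl; apply: knuth_sym.
exact: knuth_column_right.
Qed.

Lemma knuth_columns_high (P : seq (nat * nat)) D :
  all (fun p => p.1 < p.2) P -> pairwise gtn (unzip1 P ++ D) ->
  knuth (unzip1 P ++ unzip2 P ++ D) (unzip1 P ++ D ++ unzip2 P).
Proof.
elim: P => [|[a b] P IH]; first by move=> *; rewrite cats0; exact: knuth_refl.
rewrite /= all_cat => /andP[ab aP] /andP[/andP[aP1 aD] sD].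
have sP : pairwise gtn (unzip1 P) by move: sD; rewrite pairwise_cat; case/and3P.
apply: (knuth_trans (v := [:: a; b] ++ unzip1 P ++ unzip2 P ++ D)).
  by have := knuth_catr (unzip2 P ++ D) (knuth_column_left sP aP1 ab); rewrite /= -!catA /=.
apply: (knuth_trans (v := [:: a; b] ++ unzip1 P ++ D ++ unzip2 P)).
  by apply: knuth_catl; exact: IH.
have := knuth_catr (unzip2 P) (knuth_column_left sD _ ab).
rewrite all_cat aP1 aD /= -!catA /= => h; exact: knuth_sym (h _).
Qed.

(** Three moves carry [t] into the first column: the left letters of [Q] slide right past the right
    letters of [P] and [t]; then [t] slides left past the right letters of [P]; then the left
    letters of [Q] slide back past the right letters of [P]. *)
Lemma knuth_columns (X : seq nat) (P Q : seq (nat * nat)) t :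
  all (fun p => p.1 < p.2) P -> all (fun p => p.1 < p.2) Q ->
  pairwise gtn (unzip1 P ++ [:: t]) -> pairwise gtn (unzip2 P ++ t :: unzip2 Q) ->
  knuth ((X ++ unzip1 P ++ unzip1 Q) ++ (unzip2 P ++ t :: unzip2 Q))
        ((X ++ unzip1 P ++ t :: unzip1 Q) ++ (unzip2 P ++ unzip2 Q)).
Proof.
move=> aP aQ s1 s2; rewrite -!catA; apply: knuth_catl.
apply: (knuth_trans (v := unzip1 P ++ (rcons (unzip2 P) t) ++ unzip1 Q ++ unzip2 Q)).
  apply: knuth_catl; rewrite -cat_rcons; apply: knuth_columns_low => //.
  by rewrite cat_rcons.
apply: (knuth_trans (v := unzip1 P ++ [:: t] ++ unzip2 P ++ unzip1 Q ++ unzip2 Q)).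
  by have := knuth_catr (unzip1 Q ++ unzip2 Q) (knuth_columns_high aP s1);
    rewrite -cats1 -!catA.
apply: knuth_catl; apply: (knuth_catl [:: t]); apply: knuth_sym.
apply: knuth_columns_low => //.
apply: subseq_pairwise s2; rewrite subseq_cat2l; exact: subseq_cons.
Qed.

Lemma sub_in_count (T : eqType) (p q : pred T) (s : seq T) :
  {in s, forall x, p x -> q x} -> count p s <= count q s.
Proof.
elim: s => //= x s IH h; apply: leq_add.
  by case px: (p x) => //; rewrite h ?inE ?eqxx.
by apply: IH => y ys; apply: h; rewrite inE ys orbT.
Qed.

Lemma sort_geqE s : sort geq s = rev (sort leq s).
Proof.
apply: (sorted_eq (leT := geq)).
- by move=> y x z /= xy yz; apply: leq_trans yz xy.
- by move=> x y /=; rewrite andbC; exact: anti_leq.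
- by apply: sort_sorted => x y /=; exact: leq_total.
- by rewrite rev_sorted; apply: (sort_sorted leq_total).
- by rewrite perm_sort perm_sym perm_rev perm_sort.
Qed.

Lemma sort_leq_ltn s : uniq s -> sorted ltn (sort leq s).
Proof.
move=> us; have := sort_sorted leq_total s.
by rewrite ltn_sorted_uniq_leq sort_uniq us.
Qed.

Lemma sort_geq_gtn s : uniq s -> pairwise gtn (sort geq s).
Proof.
move=> us; rewrite -sorted_pairwise; last by move=> y x z /= xy yz; apply: ltn_trans yz xy.
by rewrite sort_geqE rev_sorted sort_leq_ltn.
Qed.

Lemma pairwise_gtn_eq s1 s2 : perm_eq s1 s2 -> pairwise gtn s1 -> pairwise gtn s2 -> s1 = s2.
Proof.
have tr : transitive gtn by move=> y x z /= xy yz; apply: ltn_trans yz xy.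
move=> p12; rewrite -!sorted_pairwise // => h1 h2.
by apply: (sorted_eq tr) => // x y /=; lia.
Qed.

Lemma pairwise_gtn_uniq s : pairwise gtn s -> uniq s.
Proof. by apply: (@pairwise_uniq _ gtn) => x /=; rewrite ltnn. Qed.

(** Take for [v] the entry of [B] at [i]: at least [i.+1] letters of [B] are at most [v], whereas at
    most [i] letters of [A] would be less than [v] if the entry of [A] at [i] were not. *)
Lemma nth_lt_of_count A B i : sorted leq A -> sorted leq B ->
  (forall v, count (fun x => x <= v) B <= count (fun x => x < v) A) ->
  i < size B -> nth 0 A i < nth 0 B i.
Proof.
move=> sA sB h iB; rewrite ltnNge; apply/negP => AB.
have := h (nth 0 B i); apply/negP; rewrite -ltnNge; set v := nth 0 B i.
apply: (@leq_ltn_trans i).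
  rewrite -(cat_take_drop i A) count_cat -[X in _ <= X]addn0 leq_add //.
    by apply: leq_trans (count_size _ _) _; rewrite size_take; case: ltnP => // /ltnW.
  rewrite leqNgt -has_count; apply/negP => /(has_nthP 0)[j].
  rewrite size_drop nth_drop => jA.
  have := sorted_leq_nth leq_trans leqnn 0 sA (i) (i+j).
  rewrite !inE => /(_ _ _ (leq_addr _ _)) => H; have := H; lia.
rewrite -(cat_take_drop i.+1 B) count_cat ltn_addr //.
suff /eqP -> : count (fun x => x <= v) (take i.+1 B) == size (take i.+1 B).
  by rewrite size_takel.
rewrite -all_count; apply/(all_nthP 0) => j; rewrite size_takel // => ji.
rewrite nth_take //.
by apply: (sorted_leq_nth leq_trans leqnn 0 sB); rewrite ?inE; lia.
Qed.

Lemma gtn_all_zip A B : size B <= size A ->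
  (forall i, i < size B -> nth 0 A i < nth 0 B i) -> all (fun p => p.1 < p.2) (zip A B).
Proof.
elim: B A => [|b B IH] [|a A] //= sAB h.
by rewrite (h 0) //=; apply: IH => // i iB; exact: (h i.+1).
Qed.

Lemma count_split t s (p : pred nat) : t \notin s ->
  count p s = count p [seq x <- s | x < t] + count p [seq x <- s | t < x].
Proof.
elim: s => //= x s IH; rewrite inE negb_or => /andP[tx /IH ->].
by case: ltngtP tx => //=; lia.
Qed.

(* The hypotheses say that the rows of the columns [A] and [B] can be matched, and that
   [t] is the first letter of [B + t] which has no place left next to [A]. *)
Lemma knuth_move_letter (A B : seq nat) t :
  uniq (t :: A) -> uniq (t :: B) ->
  (forall v, count (fun x => x <= v) B <= count (fun x => x < v) A) ->
  count (fun x => x < t) A <= count (fun x => x < t) B ->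
  knuth (sort geq A ++ sort geq (t :: B)) (sort geq (t :: A) ++ sort geq B).
Proof.
move=> /= /andP[tA uA] /andP[tB uB] h ht.
pose lo s := sort leq [seq x <- s | x < t]; pose hi s := sort leq [seq x <- s | t < x].
have lo_sorted s : sorted leq (lo s) by exact: sort_sorted leq_total _.
have hi_sorted s : sorted leq (hi s) by exact: sort_sorted leq_total _.
have splitE s : t \notin s -> uniq s -> sort geq s = rev (hi s) ++ rev (lo s) /\
    sort geq (t :: s) = rev (hi s) ++ t :: rev (lo s).
  move=> ts us.
  have ph : perm_eq (rev (hi s)) [seq x <- s | t < x] by rewrite perm_rev perm_sort.
  have pl : perm_eq (rev (lo s)) [seq x <- s | x < t] by rewrite perm_rev perm_sort.
  have phl : perm_eq s (rev (hi s) ++ rev (lo s)).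
    rewrite perm_sym (perm_trans (perm_cat ph pl)) //.
    have -> : [seq x <- s | x < t] = [seq x <- s | predC (fun x => t < x) x].
      apply: eq_in_filter => x xs /=; rewrite -leqNgt [RHS]leq_eqVlt.
      by case: (x =P t) => // e; move: ts; rewrite -e xs.
    exact: (permEl (perm_filterC (fun x => t < x) s)).
  have ppt : pairwise gtn (rev (hi s) ++ t :: rev (lo s)).
    rewrite pairwise_cat allrel_consr /=; apply/and4P; split.
    - apply/andP; split.
        by apply/allP => x; rewrite (perm_mem ph) mem_filter /= => /andP[].
      apply/allrelP => x y; rewrite (perm_mem ph) (perm_mem pl) !mem_filter /=.
      by move=> /andP[h1 _] /andP[h2 _]; exact: ltn_trans h2 h1.
    - by rewrite -sort_geqE sort_geq_gtn // filter_uniq.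
    - by apply/allP => x; rewrite (perm_mem pl) mem_filter /= => /andP[].
    - by rewrite -sort_geqE sort_geq_gtn // filter_uniq.
  split; apply: pairwise_gtn_eq; rewrite ?sort_geq_gtn //=.
  - by rewrite perm_sort.
  - by apply: subseq_pairwise ppt; rewrite subseq_cat2l; exact: subseq_cons.
  - by rewrite perm_sort perm_sym (perm_catCA _ [:: t] _) perm_cons perm_sym.
  - by rewrite ts.
have [-> ->] := splitE A tA uA; have [-> ->] := splitE B tB uB.
have cE s p : t \notin s -> count p s = count p (lo s) + count p (hi s).
  by move=> /count_split ->; rewrite !(seq.permP (permEl (perm_sort _ _))).
have lo_lt s x : x \in lo s -> x < t by rewrite mem_sort mem_filter => /andP[].
have hi_gt s x : x \in hi s -> t < x by rewrite mem_sort mem_filter => /andP[].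
have c_lo s (p : pred nat) : (forall x, x < t -> p x) -> count p (lo s) = size (lo s).
  by move=> hp; apply/eqP; rewrite -all_count; apply/allP => x /lo_lt; exact: hp.
have c_hi s (p : pred nat) : (forall x, t < x -> ~~ p x) -> count p (hi s) = 0.
  by move=> hp; apply/eqP; rewrite eqn0Ngt -has_count; apply/hasPn => x /hi_gt; exact: hp.
have size_lo s : size (lo s) = count (fun x => x < t) s by rewrite size_sort size_filter.
(* The hypothesis on [t] and the counting hypothesis at [t] are opposite inequalities, so below [t]
   the two columns pair off exactly. *)
have sz_lo : size (lo A) = size (lo B).
  apply/eqP; rewrite !size_lo eqn_leq ht; apply: leq_trans (h t).
  by apply: sub_count => x; exact: ltnW.
have h_lo v : count (fun x => x <= v) (lo B) <= count (fun x => x < v) (lo A).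
  have [tv|tv] := leqP t v.
    rewrite (c_lo A) ?sz_lo ?count_size // => x xt; exact: leq_trans xt tv.
  have := h v; rewrite (cE A) // (cE B) // (c_hi A) ?addn0.
    by apply: leq_trans; exact: leq_addr.
  by move=> x tx; rewrite -leqNgt ltnW // (ltn_trans tv).
have h_hi v : count (fun x => x <= v) (hi B) <= count (fun x => x < v) (hi A).
  have [tv|tv] := ltnP v t.
    by rewrite c_hi // => x tx; rewrite -ltnNge (ltn_trans tv).
  have := h v; rewrite (cE A) // (cE B) // (c_lo A) ?(c_lo B) ?sz_lo ?leq_add2l // => x xt.
    exact: ltnW (leq_trans xt tv).
  exact: leq_trans xt tv.
have sz_hi : size (hi B) <= size (hi A).
  apply: leq_trans (count_size (fun x => x < \max_(y <- hi B) y) (hi A)).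
  apply: leq_trans (h_hi _).
  suff /eqP -> : count (fun x => x <= \max_(y <- hi B) y) (hi B) == size (hi B) by [].
  by rewrite -all_count; apply/allP => x xB; exact: leq_bigmax_seq.
(* Above [t] the smallest letters of [A] are paired with those of [B]; the surplus letters of [A]
   are the largest and stand at the front, as the prefix [X] of [knuth_columns]. *)
pose m := size (hi B); pose P := zip (take m (hi A)) (hi B); pose Q := zip (lo A) (lo B).
have szt : size (take m (hi A)) = m by rewrite size_takel.
have aP : all (fun p => p.1 < p.2) (rev P).
  rewrite all_rev; apply: gtn_all_zip => [|i im]; rewrite ?szt // nth_take //.
  exact: nth_lt_of_count.
have aQ : all (fun p => p.1 < p.2) (rev Q).
  rewrite all_rev; apply: gtn_all_zip => [|i im]; rewrite ?sz_lo //.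
  exact: nth_lt_of_count.
have P1 : unzip1 (rev P) = rev (take m (hi A))
  by rewrite /unzip1 map_rev -/(unzip1 P) unzip1_zip ?szt.
have P2 : unzip2 (rev P) = rev (hi B)
  by rewrite /unzip2 map_rev -/(unzip2 P) unzip2_zip ?szt.
have Q1 : unzip1 (rev Q) = rev (lo A)
  by rewrite /unzip1 map_rev -/(unzip1 Q) unzip1_zip ?sz_lo.
have Q2 : unzip2 (rev Q) = rev (lo B)
  by rewrite /unzip2 map_rev -/(unzip2 Q) unzip2_zip ?sz_lo.
have [EA EtA] := splitE A tA uA; have [EB EtB] := splitE B tB uB.
have := @knuth_columns (rev (drop m (hi A))) (rev P) (rev Q) t aP aQ.
rewrite P1 P2 Q1 Q2 (catA (rev (drop _ _))) (catA (rev (drop _ _)) _ (t :: _)).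
rewrite -rev_cat cat_take_drop -EA -EtA -EB -EtB; apply.
  apply: subseq_pairwise (sort_geq_gtn (_ : uniq (t :: A))); last by rewrite /= tA.
  rewrite EtA -{2}(cat_take_drop m (hi A)) rev_cat -catA.
  apply: subseq_trans (suffix_subseq _ _).
  by rewrite subseq_cat2l /= eqxx sub0seq.
by rewrite sort_geq_gtn //= tB.
Qed.

(** * Insertion into a composition tableau *)

(** Rows are strict because the letters are distinct; [ct_cell] excludes the empty rows that a list
    of lists would allow. *)
Record composition_tableau (T : tableau) : Prop := CompositionTableau {
  ct_row : forall c d, is_cell T c d.+1 -> entry T c d < entry T c d.+1;
  ct_head : forall c c', c < c' -> c' < size T -> entry T c 0 < entry T c' 0;
  ct_cell : forall c, c < size T -> is_cell T c 0;
  ct_triple : forall i j d, i < j -> is_cell T i d.+1 -> is_cell T j d ->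
    entry T j d <= entry T i d.+1 ->
    is_cell T j d.+1 /\ entry T j d.+1 < entry T i d.+1 }.

Lemma is_cell_size T c d : is_cell T c d -> c < size T.
Proof.
rewrite /is_cell /row_at => h; rewrite ltnNge; apply: contraL h => h.
by rewrite nth_default.
Qed.

Lemma is_cell_pred T c d : is_cell T c d.+1 -> is_cell T c d.
Proof. exact: ltnW. Qed.

Lemma entry_set_entry T c d x c' d' :
  entry (set_entry T c d x) c' d' = if (c' == c) && (d' == d) then x else entry T c' d'.
Proof.
rewrite /entry /set_entry /row_at nth_set_nth /=; case: eqP => //= ->.
by rewrite nth_set_nth.
Qed.

Lemma is_cell_set_entry T c d x c' d' : d <= size (row_at T c) ->
  is_cell (set_entry T c d x) c' d' = ((c' == c) && (d' == d)) || is_cell T c' d'.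
Proof.
move=> h; rewrite /is_cell /set_entry /row_at nth_set_nth /=; case: eqP => //= ->.
by rewrite size_set_nth; move: h; rewrite /row_at; lia.
Qed.

Lemma size_set_entry T c d x : c < size T -> size (set_entry T c d x) = size T.
Proof. by rewrite /set_entry size_set_nth; lia. Qed.

(* Placing [k] at [(c, d.+1)] during the scan of column [d], from the top row
   down to row [c]; the last two hypotheses are what the scans of the rows of this
   column above [c], and of the previous column, have established. *)
Lemma composition_tableau_set_entry T c d k : composition_tableau T ->
  (forall c' d', is_cell T c' d' -> entry T c' d' != k) ->
  is_cell T c d -> entry T c d <= k ->
  (is_cell T c d.+1 -> k < entry T c d.+1) ->
  (forall j, c < j -> is_cell T j d -> entry T j d < k ->
     is_cell T j d.+1 /\ entry T j d.+1 < k) ->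
  (forall l, l < c -> is_cell T l d.+1 -> entry T l d.+1 < k ->
     is_cell T l d.+2 /\ entry T l d.+2 < k) ->
  composition_tableau (set_entry T c d.+1 k).
Proof.
move=> [rowT headT cellT tripT] fr cd cdk cd1 above below.
have cT := is_cell_size cd.
have cellE c' d' : is_cell (set_entry T c d.+1 k) c' d' =
    ((c' == c) && (d' == d.+1)) || is_cell T c' d' by apply: is_cell_set_entry.
have ltk c' d' : is_cell T c' d' -> entry T c' d' <= k -> entry T c' d' < k.
  by move=> h1 h2; rewrite ltn_neqAle fr.
have gtk c' d' : is_cell T c' d' -> k <= entry T c' d' -> k < entry T c' d'.
  by move=> h1 h2; rewrite ltn_neqAle eq_sym fr.
have dn d0 : (d0 == d0.+1) = false by rewrite ltn_eqF.
split.
- move=> c0 d0; rewrite cellE !entry_set_entry.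
  have [->|_] /= := eqVneq c0 c; last exact: rowT.
  rewrite eqSS; have [->|nd] /= := eqVneq d0 d.
    by rewrite dn => _; exact: ltk.
  have [->|_] /= := eqVneq d0 d.+1; last exact: rowT.
  by move=> cd2; apply: ltn_trans (cd1 (is_cell_pred cd2)) (rowT _ _ cd2).
- by move=> c1 c2 c12; rewrite size_set_entry // !entry_set_entry !andbF; exact: headT.
- by move=> c1; rewrite size_set_entry // cellE andbF; exact: cellT.
- move=> i j e ij; rewrite !cellE !entry_set_entry !eqSS.
  have [ei|ni] /= := eqVneq i c.
    have nj : (j == c) = false by rewrite -ei gtn_eqF.
    rewrite nj /=; have [->|ne] /= := eqVneq e d; last by rewrite ei; apply: tripT; rewrite -ei.
    by move=> _ cj ejk; apply: above; rewrite -?ei //; exact: ltk.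
  have [ej|nj] /= := eqVneq j c; last exact: tripT.
  (* The new entry is the upper left cell of the triple. The hypothesis on lower rows excludes
     [entry T i d.+1 < k], so the triple condition applies in column [d] and then again in column
     [d.+1]. *)
  have [->|ne] /= := eqVneq e d.+1.
    rewrite gtn_eqF //= => ci2 _ /(gtk _ _ ci2) kei2; rewrite ej.
    have ci1 := is_cell_pred ci2; have ltci := rowT _ _ ci2.
    have ic : i < c by rewrite -ej.
    have [kei1|eik1] := leqP k (entry T i d.+1); last first.
      by have [_] := below _ ic ci1 eik1; rewrite ltnNge (ltnW kei2).
    have [cd1T h1] := tripT _ _ _ ic ci1 cd (leq_trans cdk kei1).
    by apply: tripT => //; exact: ltnW (ltn_trans h1 ltci).
  (* Here the new entry is the upper right cell: the triple condition held with the old entry, and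
     the new one is smaller. *)
  have [->|ne'] /= := eqVneq e d; last by rewrite ej; apply: tripT; rewrite -ej.
  move=> ci1 _ h; have ic : i < c by rewrite -ej.
  rewrite -{1}ej in cd; rewrite ej in h.
  have [] := tripT _ _ _ ij ci1 cd; first by rewrite ej.
  by rewrite ej => h1 h2; split=> //; exact: ltn_trans (cd1 h1) h2.
Qed.

(** * Columns and the column word during an insertion *)

Definition column (T : tableau) (d : nat) : seq nat := [seq nth 0 r d | r <- T & d < size r].

Lemma column_cat T1 T2 d : column (T1 ++ T2) d = column T1 d ++ column T2 d.
Proof. by rewrite /column filter_cat map_cat. Qed.

Lemma count_column p T d :
  count p (column T d) = count (fun c => is_cell T c d && p (entry T c d)) (iota 0 (size T)).
Proof.
rewrite /column count_map count_filter.
rewrite -{1}(mkseq_nth [::] T) /mkseq count_map; apply: eq_count => c /=.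
by rewrite andbC.
Qed.

Lemma mem_column T d x :
  reflect (exists2 c, is_cell T c d & entry T c d = x) (x \in column T d).
Proof.
apply: (iffP mapP) => [[r]|[c cd <-]].
  rewrite mem_filter => /andP[dr /(nthP [::])[c cT er]] ->; exists c.
    by rewrite /is_cell /row_at er.
  by rewrite /entry /row_at er.
exists (row_at T c) => //; rewrite mem_filter; apply/andP; split=> //.
exact: mem_nth (is_cell_size cd).
Qed.

Lemma set_entry_cons r T c d x : set_entry (r :: T) c.+1 d x = r :: set_entry T c d x.
Proof. by []. Qed.

Lemma column_cons r T d : column (r :: T) d =
  if d < size r then nth 0 r d :: column T d else column T d.
Proof. by rewrite /column /=; case: ifP. Qed.

Lemma column_set_entry_neq T c d x d' : d <= size (row_at T c) -> c < size T ->
  d' != d -> column (set_entry T c d x) d' = column T d'.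
Proof.
move=> + + nd; elim: T c => [//|r T IH] [|c] dr cT; last first.
  by rewrite set_entry_cons !column_cons IH.
rewrite /set_entry /= !column_cons /= nth_set_nth /= (negbTE nd) size_set_nth.
rewrite (_ : (d' < maxn d.+1 (size r)) = (d' < size r)) //.
by move: nd dr; rewrite /row_at /=; lia.
Qed.

Lemma perm_column_set_entry T c d x : is_cell T c d ->
  perm_eq (entry T c d :: column (set_entry T c d x) d) (x :: column T d).
Proof.
elim: T c => [|r T IH] [|c] cd //; last first.
  rewrite set_entry_cons !column_cons; case: ifP => _; last exact: IH.
  rewrite (perm_catCA [:: _] [:: _]) /= perm_sym (perm_catCA [:: _] [:: _]) /= perm_cons perm_sym.
  exact: IH.
rewrite /set_entry !column_cons /= nth_set_nth /= eqxx size_set_nth.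
rewrite /is_cell /row_at /= in cd; rewrite cd /row_at /= leq_max ltnSn /=.
by rewrite (perm_catCA [:: _] [:: _]).
Qed.

Lemma perm_column_set_entry_new T c d x : d = size (row_at T c) -> c < size T ->
  perm_eq (column (set_entry T c d x) d) (x :: column T d).
Proof.
elim: T c => [|r T IH] [|c] // ed cT; last first.
  rewrite set_entry_cons !column_cons; case: ifP => _; last exact: IH.
  by rewrite perm_sym (perm_catCA [:: _] [:: _]) /= perm_cons perm_sym IH.
rewrite /row_at /= in ed.
by rewrite /set_entry !column_cons /= nth_set_nth /= eqxx size_set_nth leq_max ltnSn /= ed ltnn.
Qed.

(** The bound [W] stays fixed while the tableau grows, so that words before and after an insertion
    are made of the same columns, the last ones being possibly empty. *)
Definition columns_word (g : nat -> seq nat) (W : nat) : seq nat :=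
  flatten [seq g d | d <- iota 0 W].

Lemma columns_wordE g W e : e < W -> columns_word g W =
  columns_word g e ++ g e ++ flatten [seq g d | d <- iota e.+1 (W - e.+1)].
Proof.
move=> eW; rewrite /columns_word -{1}(subnKC (ltnW eW)) iotaD map_cat flatten_cat add0n.
by rewrite -(subnSK eW).
Qed.

Lemma eq_columns_word g g' W : {in gtn W, g =1 g'} -> columns_word g W = columns_word g' W.
Proof.
move=> gg'; congr flatten; apply/eq_in_map => d; rewrite mem_iota => /andP[_ dW].
exact: gg'.
Qed.

Definition sorted_column (T : tableau) (d : nat) : seq nat := sort geq (column T d).

(** The letter in hand [k] is counted as a member of column [e], which gives a column word at every
    moment of an insertion. *)
Definition carrying_column (T : tableau) (e k d : nat) : seq nat :=
  sort geq (if d == e then k :: column T d else column T d).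

Lemma eq_sort_geq s1 s2 : perm_eq s1 s2 -> sort geq s1 = sort geq s2.
Proof. by rewrite !sort_geqE => /(perm_sortP leq_total leq_trans anti_leq) ->. Qed.

Lemma perm_carrying_word W T e k : e < W ->
  perm_eq (columns_word (carrying_column T e k) W) (k :: columns_word (sorted_column T) W).
Proof.
move=> eW; rewrite !(columns_wordE _ eW).
have -> : columns_word (carrying_column T e k) e = columns_word (sorted_column T) e.
  by apply: eq_columns_word => d /= de; rewrite /carrying_column ltn_eqF.
have -> : [seq carrying_column T e k d | d <- iota e.+1 (W - e.+1)] =
    [seq sorted_column T d | d <- iota e.+1 (W - e.+1)].
  apply/eq_in_map => d; rewrite mem_iota => /andP[ed _].
  by rewrite /carrying_column gtn_eqF.
rewrite perm_sym -cat1s perm_catCA perm_cat2l catA perm_cat2r.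
by rewrite /carrying_column /sorted_column eqxx perm_sym perm_sort /= perm_cons perm_sym perm_sort.
Qed.

Definition width_at_most (m : nat) (T : tableau) : Prop :=
  forall c d, is_cell T c d -> d < m.

Lemma mem_columns_word W T c d : d < W -> is_cell T c d ->
  entry T c d \in columns_word (sorted_column T) W.
Proof.
move=> dW cd; apply/flattenP; exists (sorted_column T d).
  by apply: map_f; rewrite mem_iota.
by rewrite mem_sort; apply/mem_column; exists c.
Qed.

Lemma carried_fresh m W T e k : e < W -> m <= W -> width_at_most m T ->
  uniq (columns_word (carrying_column T e k) W) ->
  forall c d, is_cell T c d -> entry T c d != k.
Proof.
move=> eW mW wT; rewrite (perm_uniq (perm_carrying_word T k eW)) /= => /andP[kT _] c d cd.
by apply: contraNneq kT => <-; exact: mem_columns_word (leq_trans (wT _ _ cd) mW) cd.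
Qed.

Lemma uniq_column W T e d k : e < W -> d < W ->
  uniq (columns_word (carrying_column T e k) W) -> uniq (k :: column T d).
Proof.
move=> eW dW; rewrite (perm_uniq (perm_carrying_word T k eW)) /= => /andP[kT].
move: kT; rewrite (columns_wordE _ dW) !mem_cat !negb_or mem_sort => /and3P[_ -> _].
by rewrite !cat_uniq sort_uniq => /and3P[_ _ /andP[]].
Qed.

(** A bump exchanges the letter in hand with a letter of the column in which it is counted, so the
    contents of that column do not change. *)
Lemma carrying_word_swap W T c d k : is_cell T c d ->
  columns_word (carrying_column (set_entry T c d k) d (entry T c d)) W =
  columns_word (carrying_column T d k) W.
Proof.
move=> cd; apply: eq_columns_word => e _; rewrite /carrying_column.
have [->|ne] := eqVneq e d; first by apply: eq_sort_geq; exact: perm_column_set_entry.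
by rewrite column_set_entry_neq //; [exact: ltnW|exact: is_cell_size cd].
Qed.

Lemma carrying_word_place W T c d k : d = size (row_at T c) -> c < size T ->
  columns_word (sorted_column (set_entry T c d k)) W =
  columns_word (carrying_column T d k) W.
Proof.
move=> dT cT; apply: eq_columns_word => e _; rewrite /carrying_column /sorted_column.
have [->|ne] := eqVneq e d; first by apply: eq_sort_geq; exact: perm_column_set_entry_new.
by rewrite column_set_entry_neq // dT.
Qed.

(* A letter [k] scanning column [d] stops at none of the given rows: it can neither be
   placed at their end nor replace an entry of column [d.+1]. *)
Definition blocked (T : tableau) (k d : nat) (rows : pred nat) : Prop :=
  forall c, rows c -> is_cell T c d -> entry T c d < k ->
    is_cell T c d.+1 /\ entry T c d.+1 < k.

(** The rows from [c] upwards have been scanned in column [d]. Below [c], the last field keeps what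
    the scan of column [d.+1] established; this is what a change of row [c] will need to preserve
    the triple condition. *)
Record scan_state (m W : nat) (T : tableau) (k d c : nat) : Prop := ScanState {
  scan_ct : composition_tableau T;
  scan_width : width_at_most m T;
  scan_uniq : uniq (columns_word (carrying_column T d.+1 k) W);
  scan_above : blocked T k d (leq c);
  scan_below : blocked T k d.+1 (gtn c) }.

Definition cells_of_column (T : tableau) (d c : nat) : seq (nat * nat) :=
  [seq cd <- [seq (c', d) | c' <- rev (iota 0 c)] | is_cell T cd.1 cd.2].

Lemma cells_of_columnS T d c : cells_of_column T d c.+1 =
  if is_cell T c d then (c, d) :: cells_of_column T d c else cells_of_column T d c.
Proof. by rewrite /cells_of_column -addn1 iotaD rev_cat. Qed.

(** The list of cells is fixed before the insertion, hence [T0]; bumps keep the shape, so the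
    current tableau has the same cells. Either the letter is placed during this scan, or some letter
    leaves the column blocked everywhere. *)
Lemma YC_process_column m W T0 d c T k rest : m < W -> d.+1 < W ->
  is_cell T =2 is_cell T0 -> scan_state m W T k d c ->
  let T2 := YC_process (cells_of_column T0 d c ++ rest) T k in
  [/\ composition_tableau T2, width_at_most m.+1 T2
    & columns_word (sorted_column T2) W = columns_word (carrying_column T d.+1 k) W]
  \/ exists T1 k1, [/\ T2 = YC_process rest T1 k1, is_cell T1 =2 is_cell T0,
       scan_state m W T1 k1 d 0
     & columns_word (carrying_column T1 d.+1 k1) W =
       columns_word (carrying_column T d.+1 k) W].
Proof.
move=> mW dW; elim: c T k => [|c IH] T k TT0 st; first by right; exists T, k.
have fr := carried_fresh dW (ltnW mW) (scan_width st) (scan_uniq st).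
have keep : (is_cell T c d -> entry T c d < k -> is_cell T c d.+1 /\ entry T c d.+1 < k) ->
    scan_state m W T k d c.
  case: st => ctT wT uT ab be h; split=> //.
    by move=> j; rewrite leq_eqVlt => /predU1P[<-|] //; exact: ab.
  by move=> l lc; apply: be; exact: ltnW.
rewrite cells_of_columnS -TT0.
have [cd|ncd] := boolP (is_cell T c d); last first.
  by apply: IH => //; apply: keep; rewrite (negbTE ncd).
rewrite /=; have [cd1|ncd1] := boolP (is_cell T c d.+1); last first.
  case: leqP => h; last first.
    by apply: IH => //; apply: keep => _ /ltnW; rewrite leqNgt h.
  have e : d.+1 = size (row_at T c).
    by move: cd ncd1; rewrite /is_cell; lia.
  left; split.
  - apply: composition_tableau_set_entry (scan_ct st) fr cd h _ _ _.
    + by rewrite (negbTE ncd1).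
    + exact: scan_above st.
    + by move=> l lc; apply: (scan_below st); exact: ltnW.
  - move=> c1 d1; rewrite is_cell_set_entry ?e //= => /orP[/andP[_ /eqP ->]|].
      by rewrite -e ltnS; exact: (scan_width st cd).
    by move/(scan_width st) => /ltnW.
  - by rewrite carrying_word_place //; exact: is_cell_size cd.
case: ifP => [/andP[h1 h2]|h]; last first.
  apply: IH => //; apply: keep => _ h'; split=> //.
  by move: h; rewrite (ltnW h') /= ltnNge => /negbFE h2; rewrite ltn_neqAle h2 fr.
set k1 := entry T c d.+1; set T1 := set_entry T c d.+1 k.
have cT := is_cell_size cd.
have ct1 : composition_tableau T1.
  apply: composition_tableau_set_entry (scan_ct st) fr cd h1 _ _ _ => //.
    exact: scan_above st.
  by move=> l lc; apply: (scan_below st); exact: ltnW.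
have cell1 : is_cell T1 =2 is_cell T.
  move=> c1 d1; rewrite is_cell_set_entry; last exact: ltnW.
  by case: andP => // -[/eqP -> /eqP ->]; rewrite cd1.
have e1 : columns_word (carrying_column T1 d.+1 k1) W =
    columns_word (carrying_column T d.+1 k) W by exact: carrying_word_swap.
(* The letter in hand grows from [k] to [k1], so entries between the two must be reconsidered. The
   triple condition with row [c] blocks [k1] at such an entry of column [d] above [c], and shows
   that column [d.+1] has no such entry below [c]. *)
have st1 : scan_state m W T1 k1 d c.
  split=> //.
  - by move=> c1 d1; rewrite cell1; exact: scan_width st _ _.
  - by rewrite e1; exact: scan_uniq st.
  - move=> j; rewrite !cell1 !entry_set_entry leq_eqVlt => /predU1P[<-|cj] jd.
      by rewrite !eqxx cd1.
    rewrite (gtn_eqF cj) /= => jk1.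
    have [jk|kj] := ltnP (entry T j d) k.
      have [h3 h4] := scan_above st cj jd jk.
      by split=> //; exact: ltn_trans h4 h2.
    exact: (ct_triple (scan_ct st)) cj cd1 jd (ltnW jk1).
  - move=> l lc; rewrite !cell1 !entry_set_entry /= (ltn_eqF lc) /= => ld1 lk1.
    have [lk|kl] := ltnP (entry T l d.+1) k.
      have [h3 h4] := scan_below st (ltnW lc : gtn c.+1 l) ld1 lk.
      by split=> //; exact: ltn_trans h4 h2.
    have [_] := ct_triple (scan_ct st) lc ld1 cd (leq_trans h1 kl).
    by move/(ltn_trans lk1); rewrite ltnn.
have [[h3 h4 h5]|[T2 [k2 [h3 h4 h5 h6]]]] := IH _ _ (fun c d => etrans (cell1 c d) (TT0 c d)) st1.
  by left; split=> //; rewrite h5.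
by right; exists T2, k2; split=> //; rewrite h6.
Qed.

(** The rows provide both counts: an entry of column [d.+1] has a smaller one to its left, and, as
    [k] is blocked, an entry less than [k] in column [d] is continued by another one less than
    [k]. *)
Lemma knuth_blocked T k d : composition_tableau T ->
  uniq (k :: column T d) -> uniq (k :: column T d.+1) -> blocked T k d predT ->
  knuth (sort geq (column T d) ++ sort geq (k :: column T d.+1))
        (sort geq (k :: column T d) ++ sort geq (column T d.+1)).
Proof.
move=> ctT u1 u2 bl; apply: knuth_move_letter => // [v|]; rewrite !count_column;
  apply: sub_count => c /andP[cd h]; apply/andP.
  by split; [exact: is_cell_pred|exact: leq_trans (ct_row ctT cd) h].
exact: bl.
Qed.

Lemma row_at_new_row T k c : let i := find (fun r => k < head 0 r) T in
  row_at (new_row T k) c =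
  if c < i then row_at T c else if c == i then [:: k] else row_at T c.-1.
Proof.
move=> i; have iT : i <= size T by exact: find_size.
rewrite /row_at /new_row -/i nth_cat size_takel //.
case: ltngtP => [ci|ic|->]; first by rewrite nth_take.
  have -> : c - i = (c.-1 - i).+1 by lia.
  by rewrite /= nth_drop; congr (nth _ _); lia.
by rewrite subnn.
Qed.

Lemma composition_tableau_new_row T k : composition_tableau T ->
  (forall c d, is_cell T c d -> entry T c d != k) -> blocked T k 0 predT ->
  composition_tableau (new_row T k).
Proof.
move=> ctT fr bl; set i := find (fun r => k < head 0 r) T.
have iT : i <= size T by exact: find_size.
have lo c : c < i -> entry T c 0 < k.
  move=> ci; rewrite ltn_neqAle fr ?(ct_cell ctT (leq_trans ci iT)) //.
  by rewrite leqNgt /entry nth0 (before_find [::] ci).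
have hi c : i <= c -> c < size T -> k < entry T c 0.
  move=> ic cT; have ki : k < entry T i 0.
    rewrite /entry nth0; apply: (@nth_find _ [::] (fun r => k < head 0 r)).
    by rewrite has_find; exact: leq_ltn_trans cT.
  move: ic; rewrite leq_eqVlt => /predU1P[<-|ic] //.
  by apply: ltn_trans ki _; exact: (ct_head ctT).
have sz : size (new_row T k) = (size T).+1.
  by rewrite /new_row -/i size_cat /= size_takel // size_drop addnS subnKC.
have rowE c : row_at (new_row T k) c =
  if c < i then row_at T c else if c == i then [:: k] else row_at T c.-1.
  exact: row_at_new_row.
split.
- move=> c d; rewrite /is_cell /entry rowE.
  by case: ifP => _; last case: ifP => _ //; exact: (ct_row ctT).
- move=> c c' cc'; rewrite sz ltnS /entry !rowE => c'T.
  case: (ltngtP c i) => [ci|ic|ci]; case: (ltngtP c' i) => [ci'|ic'|ci'] //=; try lia.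
  + by apply: (ct_head ctT) => //; lia.
  + by apply: (ct_head ctT) => //; lia.
  + by apply: lo.
  + by apply: (ct_head ctT) => //; lia.
  + by apply: hi; lia.
- move=> c; rewrite sz /is_cell rowE => cT.
  case: (ltngtP c i) => [ci|ic|ci] //.
    by apply: (@ct_cell _ ctT c); lia.
  by apply: (@ct_cell _ ctT c.-1); lia.
- move=> a b d ab; rewrite /is_cell /entry !rowE.
  case: (ltngtP a i) => [ai|ia|ai]; case: (ltngtP b i) => [bi|ib|bi] //=; try lia.
  + by move=> h1 h2 h3; exact: (ct_triple ctT) ab h1 h2 h3.
  + by move=> h1 h2 h3; apply: (@ct_triple _ ctT a b.-1 d) => //; lia.
  (* The new row is the upper row of the triple. A lower row starts below [k], so its second entry
     is less than [k] by blocking, and the premise of the triple condition fails. *)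
  + case: d => [|d] //= h1 _ h3.
    by have [_] := bl a isT (is_cell_pred (h1 : is_cell T a 1)) (lo _ ai); rewrite /entry ltnNge h3.
  + by move=> h1 h2 h3; apply: (@ct_triple _ ctT a.-1 b.-1 d) => //; lia.
Qed.

Lemma column_new_row T k d : perm_eq (column (new_row T k) d)
  (if d == 0 then k :: column T d else column T d).
Proof.
rewrite /new_row; set i := find (fun r => k < head 0 r) T; rewrite column_cat column_cons.
have -> : column T d = column (take i T) d ++ column (drop i T) d.
  by rewrite -column_cat cat_take_drop.
case: d => [|d] //=; by rewrite -cat1s perm_catCA.
Qed.

(** Invariant: the letter in hand is counted in column [d] and has been blocked by every row there.
    The scan of the column to the left preserves the word; if the letter survives it, one use of
    [knuth_blocked] moves it there. In column 0 it becomes a new row. *)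
Lemma YC_process_columns m W T0 d T k : m < W -> d <= m ->
  is_cell T =2 is_cell T0 -> composition_tableau T -> width_at_most m T ->
  uniq (columns_word (carrying_column T d k) W) -> blocked T k d predT ->
  let T2 := YC_process
    (flatten [seq cells_of_column T0 e (size T0) | e <- rev (iota 0 d)]) T k in
  [/\ composition_tableau T2, width_at_most m.+1 T2
    & knuth (columns_word (sorted_column T2) W) (columns_word (carrying_column T d k) W)].
Proof.
move=> mW; elim: d T k => [|d IH] T k dm TT0 ctT wT uT bl.
  have fr := carried_fresh (leq_trans _ mW) (ltnW mW) wT uT.
  rewrite /=; split.
  - by apply: composition_tableau_new_row => //; exact: fr.
  - move=> c d; rewrite /is_cell row_at_new_row; case: ifP => _; last case: ifP => _.
    + by move/wT => /ltnW.
    + by case: d.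
    + by move/wT => /ltnW.
  - rewrite (@eq_columns_word _ (carrying_column T 0 k)); first exact: knuth_refl.
    by move=> e _; apply: eq_sort_geq; exact: column_new_row.
have dW : d.+1 < W by exact: leq_ltn_trans mW.
rewrite -{1}addn1 iotaD rev_cat /=.
have st : scan_state m W T k d (size T0).
  split=> //; last by move=> c _; exact: bl.
  by move=> j Tj; rewrite TT0 => /is_cell_size; rewrite ltnNge Tj.
have [[h1 h2 h3]|[T1 [k1 [h1 h2 h3 h4]]]] :=
    YC_process_column (flatten [seq cells_of_column T0 e (size T0) | e <- rev (iota 0 d)])
      mW dW TT0 st.
  by split=> //; rewrite h3; exact: knuth_refl.
rewrite h1.
have bl1 : blocked T1 k1 d predT by move=> c _; exact: (scan_above h3).
have kn : knuth (columns_word (carrying_column T1 d k1) W)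
    (columns_word (carrying_column T1 d.+1 k1) W).
  rewrite !(columns_wordE _ (ltnW dW)) -(subnSK dW) /=.
  set Q := iota _ _.
  have -> : columns_word (carrying_column T1 d k1) d = columns_word (carrying_column T1 d.+1 k1) d.
    by apply: eq_columns_word => e /= ed; rewrite /carrying_column !ltn_eqF // ltnW.
  have -> : [seq carrying_column T1 d k1 e | e <- Q] = [seq carrying_column T1 d.+1 k1 e | e <- Q].
    apply/eq_in_map => e; rewrite mem_iota => /andP[ed _].
    by rewrite /carrying_column !gtn_eqF // ltnW.
  apply: knuth_catl; rewrite !catA; apply: knuth_catr.
  rewrite /carrying_column !eqxx gtn_eqF // ltn_eqF //; apply: knuth_sym.
  apply: knuth_blocked => //; first exact: scan_ct h3.
    exact: (uniq_column dW (ltnW dW) (scan_uniq h3)).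
  exact: (uniq_column dW dW (scan_uniq h3)).
have [|g1 g2 g3] := IH T1 k1 (ltnW dm) h2 (scan_ct h3) (scan_width h3) _ bl1.
  by rewrite (perm_uniq (knuth_perm kn)); exact: scan_uniq h3.
split=> //; rewrite -h4; exact: knuth_trans g3 kn.
Qed.

Lemma reading_cellsE T : reading_cells T =
  flatten [seq cells_of_column T e (size T) | e <- rev (iota 0 (\max_(m <- shape T) m))].
Proof. by rewrite /reading_cells filter_flatten -map_comp. Qed.

(** At the start the letter is counted in the first empty column [wd], where it is the last letter
    of the column word and is blocked vacuously; [m < W] leaves room for this column. *)
Lemma YC_insert_spec m W T k : m < W -> composition_tableau T -> width_at_most m T ->
  uniq (rcons (columns_word (sorted_column T) W) k) ->
  [/\ composition_tableau (YC_insert T k), width_at_most m.+1 (YC_insert T k)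
    & knuth (columns_word (sorted_column (YC_insert T k)) W)
        (rcons (columns_word (sorted_column T) W) k)].
Proof.
move=> mW ctT wT uT; rewrite /YC_insert reading_cellsE; set wd := \max_(_ <- _) _.
have wdm : wd <= m.
  apply/bigmax_leqP_seq => s /(nthP 0)[c]; rewrite size_map => cT <- _.
  rewrite (nth_map [::]) //; case E : (size _) => [//|s'].
  by apply: (wT c s'); rewrite /is_cell /row_at E.
have wide c d : is_cell T c d -> d < wd.
  move=> cd; apply: (leq_trans cd); apply: leq_bigmax_seq => //.
  by apply: map_f; apply: mem_nth; exact: is_cell_size cd.
have wW : wd < W by exact: leq_ltn_trans mW.
have nilE d : wd <= d -> column T d = [::].
  move=> wdd; case E : (column T d) => [//|x s]; have : x \in column T d by rewrite E inE eqxx.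
  by case/mem_column => c /wide; rewrite ltnNge wdd.
have e : rcons (columns_word (sorted_column T) W) k = columns_word (carrying_column T wd k) W.
  have fl (g : nat -> seq nat) n a : (forall d, a <= d -> g d = [::]) ->
      flatten [seq g d | d <- iota a n] = [::].
    elim: n a => //= n IHn a gn; rewrite gn // IHn // => d ad.
    by apply: gn; exact: ltnW.
  rewrite !(columns_wordE _ wW) !fl; first last.
  - by move=> d wdd; rewrite /sorted_column nilE // ltnW.
  - by move=> d wdd; rewrite /carrying_column gtn_eqF // nilE // ltnW.
  rewrite /sorted_column /carrying_column !eqxx nilE // !cats0 -cats1.
  congr (_ ++ _); apply: eq_columns_word => d /= dw.
  by rewrite ltn_eqF.
rewrite e in uT *; apply: YC_process_columns => //.
by move=> c _ /wide; rewrite ltnn.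
Qed.

Lemma YC_tableau_spec w : uniq w ->
  [/\ composition_tableau (YC_tableau w), width_at_most (size w) (YC_tableau w)
    & forall W, size w < W -> knuth (columns_word (sorted_column (YC_tableau w)) W) w].
Proof.
elim/last_ind: w => [|w x IH].
  move=> _; have nocell c d : is_cell [::] c d = false by rewrite /is_cell /row_at nth_nil.
  split=> [|c d|W _]; rewrite ?nocell //.
    by split=> // [c d|i j d ij]; rewrite nocell.
  suff -> : columns_word (sorted_column [::]) W = [::] by exact: knuth_refl.
  by rewrite /columns_word; elim: (iota 0 W).
rewrite rcons_uniq => /andP[xw uw]; have [ctT wT kT] := IH uw.
rewrite /YC_tableau foldl_rcons -/(YC_tableau w) size_rcons.
have spec W : size w < W -> [/\ composition_tableau (YC_insert (YC_tableau w) x),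
    width_at_most (size w).+1 (YC_insert (YC_tableau w) x)
  & knuth (columns_word (sorted_column (YC_insert (YC_tableau w) x)) W)
        (rcons (columns_word (sorted_column (YC_tableau w)) W) x)].
  move=> wW; apply: YC_insert_spec => //; rewrite rcons_uniq.
  by rewrite (perm_mem (knuth_perm (kT W wW))) xw (perm_uniq (knuth_perm (kT W wW))).
have [s1 s2 _] := spec _ (ltnSn _); split=> // W wW.
have [_ _ k1] := spec W (ltnW wW); apply: knuth_trans k1 _.
by rewrite -!cats1; apply: knuth_catr; apply: kT; exact: ltnW.
Qed.

(** * Colorings and columns *)

Lemma color_class_decreasing k f v D i : valid_coloring k f v -> subseq D v ->
  pairwise gtn D -> i < k -> size (color_class f i D) <= 1.
Proof.
move=> vf Dv gD ik.
have sub : subseq (color_class f i D) (color_class f i v).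
  by rewrite subseq_filter filter_all (subseq_trans (filter_subseq _ _) Dv).
have : pairwise ltn (color_class f i D).
  by apply: subseq_pairwise sub _; rewrite -sorted_ltn_pairwise; exact: vf.
have : pairwise gtn (color_class f i D) by exact: pairwise_filter.
case: (color_class f i D) => [|x [|y s]] //= /andP[/andP[yx _] _] /andP[/andP[xy _] _].
by have := ltn_trans yx xy; rewrite ltnn.
Qed.

Lemma colors_uniq k f v D : valid_coloring k f v -> subseq D v -> pairwise gtn D ->
  uniq [seq f x | x <- D & f x < k].
Proof.
move=> vf Dv gD; rewrite map_inj_in_uniq ?filter_uniq ?pairwise_gtn_uniq //.
move=> x y; rewrite !mem_filter => /andP[fx xD] /andP[fy yD] fxy.
have := color_class_decreasing vf Dv gD fx.
have : x \in color_class f (f x) D by rewrite mem_filter eqxx.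
have : y \in color_class f (f x) D by rewrite mem_filter fxy eqxx.
by case: color_class => [|z [|? ?]] //; rewrite !inE => /eqP -> /eqP ->.
Qed.

Lemma weight_decreasing k f v D : valid_coloring k f v -> subseq D v -> pairwise gtn D ->
  weight k f D <= minn k (size D).
Proof.
move=> vf Dv gD; rewrite leq_min count_size andbT.
have := uniq_leq_size (s2 := iota 0 k) (colors_uniq vf Dv gD).
rewrite size_map size_filter size_iota; apply=> i /mapP[x + ->].
by rewrite mem_filter mem_iota => /andP[].
Qed.

Lemma count_nth_sum (p : pred nat) r W : size r <= W ->
  count p r = \sum_(0 <= d < W) ((d < size r) && p (nth 0 r d)).
Proof.
move=> rW; rewrite -sum1_count (big_nth 0) (big_cat_nat _ rW) //= [X in _ = _ + X]big1_seq ?addn0.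
  rewrite [RHS]big_nat_cond big_mkcond /= [LHS]big_nat_cond; apply: eq_bigr => d.
  by rewrite andbT => /andP[_ ->] /=; case: (p _).
by move=> d; rewrite mem_index_iota => /andP[_ /andP[h _]]; rewrite ltnNge h.
Qed.

Lemma count_flatten_columns (p : pred nat) (T : tableau) W : all (fun r => size r <= W) T ->
  count p (flatten T) = \sum_(0 <= d < W) count p (column T d).
Proof.
elim: T => [|r T IH] /=; first by rewrite big1_seq.
move=> /andP[rW TW]; rewrite count_cat IH // (count_nth_sum _ rW) -big_split /=.
by apply: eq_bigr => d _; rewrite column_cons; case: ifP.
Qed.

Lemma size_column T d : size (column T d) = count (ltn d) (shape T).
Proof. by rewrite size_map size_filter count_map. Qed.

Lemma count_take_sorted s k d : sorted geq s ->
  count (ltn d) (take k s) = minn k (count (ltn d) s).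
Proof.
elim: s k => [|x s IH] [|k] //= sx; rewrite ?min0n // IH; last exact: path_sorted sx.
case: (ltnP d x) => dx; first by rewrite !add1n minnSS.
rewrite (_ : count (ltn d) s = 0) ?minn0 //.
apply/eqP; rewrite eqn0Ngt -has_count; apply/hasPn => y ys; rewrite -leqNgt.
move: sx; rewrite (path_sortedE (leT := geq)) => [/andP[/allP h _]|a b c /= h1 h2].
  by apply: leq_trans dx; exact: h.
exact: leq_trans h2 h1.
Qed.

Lemma sumn_count s W : all (leq^~ W) s -> sumn s = \sum_(0 <= d < W) count (ltn d) s.
Proof.
elim: s => [|x s IH] /=; first by rewrite big1_seq.
move=> /andP[xW sW]; rewrite IH // big_split /=; congr (_ + _).
rewrite (big_cat_nat _ xW) //= [X in _ = _ + X]big1_seq ?addn0.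
  rewrite big_nat_cond (eq_bigr (fun => 1)) => [|d /andP[/andP[_ ->]]] //.
  by rewrite -big_nat_cond sum_nat_const_nat subn0 muln1.
by move=> d; rewrite mem_index_iota => /andP[_ /andP[h _]]; rewrite ltnNge h.
Qed.

(** Double counting of the cells of the [k] longest rows, by rows and by columns. *)
Lemma sumn_take_sorted s k W : sorted geq s -> all (leq^~ W) s ->
  sumn (take k s) = \sum_(0 <= d < W) minn k (count (ltn d) s).
Proof.
move=> ss sW; rewrite (@sumn_count _ W).
  by apply: eq_bigr => d _; exact: count_take_sorted.
by apply/allP => x /mem_take; exact: (allP sW).
Qed.

Lemma weight_sum k f v : weight k f v = \sum_(0 <= i < k) size (color_class f i v).
Proof.
elim: k => [|k IH]; first by rewrite big_geq // /weight; elim: v.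
rewrite big_nat_recr //= -IH /weight size_filter -count_predUI addnC.
rewrite (eq_count (a1 := predI _ _) (a2 := pred0)) ?count_pred0 => [|x /=]; last by lia.
by apply: eq_count => x /=; lia.
Qed.

(** The color of a row is its position in [rows]; color [k] means that a letter is left out. The
    properties below hold for any word containing the rows as subsequences, so they serve for the
    column word and for the row word. *)
Definition row_coloring (T : tableau) (rows : seq nat) (k x : nat) : nat :=
  let i := find (fun c => x \in row_at T c) rows in if i < size rows then i else k.

Section RowColoring.

Variables (T : tableau) (v rows : seq nat) (k : nat).
Hypotheses (uv : uniq v) (pv : perm_eq v (flatten T)).
Hypotheses (sT : all (sorted ltn) T) (subT : {in T, forall r, subseq r v}).
Hypotheses (ur : uniq rows) (rT : {in rows, forall c, c < size T}) (sr : size rows <= k).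

Lemma row_disjoint c c' x : x \in row_at T c -> x \in row_at T c' -> c = c'.
Proof.
have := uv; rewrite (perm_uniq pv); elim: T c c' => [|r T' IH] c c' /=.
  by rewrite /row_at nth_nil.
rewrite cat_uniq => /and3P[_ rT' uT'].
have mem n : x \in row_at T' n -> x \in flatten T'.
  move=> h; apply/flattenP; exists (row_at T' n) => //; apply: mem_nth.
  by rewrite ltnNge; apply: contraL h => h; rewrite /row_at nth_default.
case: c c' => [|c] [|c'] //=.
- by move=> xr /mem xT; have := hasPn rT' _ xT; rewrite /= xr.
- by move=> /mem xT xr; have := hasPn rT' _ xT; rewrite /= xr.
- by move=> h1 h2; congr _.+1; exact: IH h1 h2.
Qed.

Lemma row_coloringE x i : i < size rows ->
  (row_coloring T rows k x == i) = (x \in row_at T (nth 0 rows i)).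
Proof.
move=> ir; rewrite /row_coloring.
have [|h] := boolP (has (fun c => x \in row_at T c) rows); last first.
  rewrite -has_find (negbTE h) gtn_eqF; last exact: leq_trans ir sr.
  by symmetry; apply/negbTE; move/hasPn: h; apply; exact: mem_nth.
move=> h; rewrite -has_find h; have xr := nth_find 0 h.
apply/eqP/idP => [<-|xi] //.
apply/eqP; rewrite -(nth_uniq 0 _ ir ur) -?has_find //.
by apply/eqP; exact: row_disjoint xr xi.
Qed.

Lemma color_class_row_coloring i : i < k ->
  color_class (row_coloring T rows k) i v = if i < size rows then row_at T (nth 0 rows i) else [::].
Proof.
move=> ik; case: ifP => ir.
  have rT' : row_at T (nth 0 rows i) \in T by apply: mem_nth; apply: rT; exact: mem_nth.
  rewrite /color_class (eq_filter (a2 := mem (row_at T (nth 0 rows i)))).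
    by symmetry; apply/(subseq_uniqP uv); exact: subT.
  by move=> x /=; exact: row_coloringE.
apply/eqP; rewrite -[_ == _]negbK -has_filter; apply/hasPn => x _.
rewrite /row_coloring; case: ltnP => h; apply: contraFN ir => /eqP.
  by move<-.
by move=> e; rewrite -e ltnn in ik.
Qed.

Lemma valid_row_coloring : valid_coloring k (row_coloring T rows k) v.
Proof.
move=> i ik; rewrite color_class_row_coloring //; case: ifP => // ir.
by apply: (allP sT); apply: mem_nth; apply: rT; exact: mem_nth.
Qed.

Lemma weight_row_coloring :
  weight k (row_coloring T rows k) v = sumn [seq size (row_at T c) | c <- rows].
Proof.
rewrite weight_sum (big_cat_nat _ sr) //= [X in _ + X]big1_seq ?addn0; last first.
  move=> i; rewrite mem_index_iota => /andP[_ /andP[h1 h2]].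
  by rewrite color_class_row_coloring // ltnNge h1.
rewrite sumnE big_map [RHS](big_nth 0) big_nat_cond [RHS]big_nat_cond.
apply: eq_bigr => i /andP[/andP[_ ir] _].
by rewrite color_class_row_coloring ?ir //; exact: leq_trans ir sr.
Qed.

End RowColoring.

(** The upper bound of Greene's theorem: an increasing subsequence uses at most one letter of each
    decreasing column. *)
Lemma weight_columns k f v (T : tableau) W : valid_coloring k f v ->
  perm_eq v (flatten T) -> all (fun r => size r <= W) T ->
  (forall d, exists D, [/\ perm_eq D (column T d), subseq D v & pairwise gtn D]) ->
  weight k f v <= \sum_(0 <= d < W) minn k (count (ltn d) (shape T)).
Proof.
move=> vf pv wT hD; rewrite /weight (seq.permP pv) (count_flatten_columns _ wT).
apply: leq_sum => d _; have [D [pD sD gD]] := hD d.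
by rewrite -size_column -(perm_size pD) -(seq.permP pD); exact: (weight_decreasing vf sD gD).
Qed.

(** * First entries of the longest rows *)

Definition row_size (T : tableau) (c : nat) : nat := size (row_at T c).

(* Among rows of the same size the upper one, with larger entries in the first column,
   comes first. *)
Definition row_before (T : tableau) (a b : nat) : bool :=
  (row_size T b < row_size T a) || ((row_size T a == row_size T b) && (b <= a)).

Definition ranked_rows (T : tableau) : seq nat := sort (row_before T) (iota 0 (size T)).

Lemma row_before_total T : total (row_before T).
Proof. by move=> a b; rewrite /row_before; case: ltngtP => //= _; exact: leq_total. Qed.

Lemma row_before_trans T : transitive (row_before T).
Proof. by move=> b a c; rewrite /row_before; lia. Qed.

Lemma perm_ranked_rows T : perm_eq (ranked_rows T) (iota 0 (size T)).
Proof. by rewrite perm_sort. Qed.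

Lemma size_ranked_rows T : size (ranked_rows T) = size T.
Proof. by rewrite (perm_size (perm_ranked_rows T)) size_iota. Qed.

Lemma uniq_ranked_rows T : uniq (ranked_rows T).
Proof. by rewrite (perm_uniq (perm_ranked_rows T)) iota_uniq. Qed.

Lemma mem_ranked_rows T c : (c \in ranked_rows T) = (c < size T).
Proof. by rewrite (perm_mem (perm_ranked_rows T)) mem_iota. Qed.

Lemma ranked_rows_sorted T : pairwise (row_before T) (ranked_rows T).
Proof.
rewrite -(sorted_pairwise (@row_before_trans T)).
exact: sort_sorted (@row_before_total T) _.
Qed.

Definition ranked_sizes (T : tableau) : seq nat := [seq row_size T c | c <- ranked_rows T].

Lemma ranked_sizes_sorted T : sorted geq (ranked_sizes T).
Proof.
rewrite sorted_map; apply: sub_sorted (sort_sorted (@row_before_total T) _).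
by move=> a b; rewrite /row_before /relpre /=; lia.
Qed.

Lemma perm_ranked_sizes T : perm_eq (ranked_sizes T) (shape T).
Proof.
have -> : shape T = [seq row_size T c | c <- iota 0 (size T)].
  by rewrite /shape -{1}(mkseq_nth [::] T) /mkseq -map_comp.
by apply: perm_map; exact: perm_ranked_rows.
Qed.

Lemma take_ranked_before T k s r : s \in take k (ranked_rows T) -> r < size T ->
  r \notin take k (ranked_rows T) -> row_before T s r.
Proof.
move=> sk rT rk; have := ranked_rows_sorted T.
rewrite -{1}(cat_take_drop k (ranked_rows T)) pairwise_cat => /and3P[/allrelP h _ _].
apply: h => //; move: rT; rewrite -mem_ranked_rows -{1}(cat_take_drop k (ranked_rows T)).
by rewrite mem_cat (negbTE rk).
Qed.

Lemma count_or_leq (T : Type) (p q : pred T) s :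
  count (fun x => p x || q x) s <= count p s + count q s.
Proof. by rewrite -count_predUI; exact: leq_addr. Qed.

Lemma count_colors_leq (f : nat -> nat) (p : pred nat) s n :
  count (fun i => has (fun x => (f x == i) && p x) s) (iota 0 n) <= count p s.
Proof.
elim: s => [|x s IH] /=; first by rewrite (eq_count (a2 := pred0)) ?count_pred0.
apply: leq_trans (count_or_leq _ _ _) _; apply: leq_add => //.
case: (p x); last by rewrite (eq_count (a2 := pred0)) ?count_pred0 // => i; rewrite andbF.
rewrite (eq_count (a2 := pred1 (f x))) => [|i]; last by rewrite andbT /= eq_sym.
by rewrite count_uniq_mem ?iota_uniq // leq_b1.
Qed.

Lemma count_leq_uniq (T : eqType) (p : pred T) s t : uniq s ->
  {in s, forall x, p x -> x \in t} -> count p s <= count p t.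
Proof.
move=> us st; rewrite -!size_filter; apply: uniq_leq_size; first exact: filter_uniq.
by move=> x; rewrite !mem_filter => /andP[px xs]; rewrite px st.
Qed.

Lemma size_column_cells T d : size (column T d) = count (is_cell T ^~ d) (iota 0 (size T)).
Proof.
rewrite -count_predT count_column; apply: eq_count => c; exact: andbT.
Qed.

(** * Counting the colors that start at least at a threshold *)

Section HeadsDominated.

Variables (T : tableau) (W k : nat) (f : nat -> nat).
Let w := columns_word (sorted_column T) W.
Let top := take k (ranked_rows T).
Hypotheses (ctT : composition_tableau T) (wT : width_at_most W T).
Hypotheses (kT : k <= size T) (k0 : 0 < k).
Hypotheses (uT : forall d, uniq (column T d)).
Hypotheses (vf : valid_coloring k f w).
Hypothesis (weight_f : forall d, weight k f (column T d) = minn k (size (column T d))).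

Lemma column_order x y d d' : d < d' -> x \in column T d -> y \in column T d' ->
  f x = f y -> f x < k -> x < y.
Proof.
move=> dd' xd yd' fxy fxk; have := vf fxk; rewrite sorted_ltn_pairwise.
have d'W : d' < W by case/mem_column: yd' => c /wT.
rewrite /w (columns_wordE _ d'W) color_class_cat pairwise_cat => /and3P[/allrelP h _ _].
apply: h; rewrite mem_filter; first rewrite eqxx.
  apply/flattenP; exists (sorted_column T d); last by rewrite mem_sort.
  by apply: map_f; rewrite mem_iota.
by rewrite fxy eqxx mem_cat mem_sort yd'.
Qed.

Lemma column_subseq d : subseq (sorted_column T d) w.
Proof.
have [dW|Wd] := ltnP d W.
  rewrite /w (columns_wordE _ dW).
  by apply: subseq_trans (suffix_subseq _ _); exact: prefix_subseq.
suff -> : sorted_column T d = [::] by exact: sub0seq.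
rewrite /sorted_column; suff -> : column T d = [::] by [].
case E : (column T d) => [//|x s]; have : x \in column T d by rewrite E inE eqxx.
by case/mem_column => c /wT; rewrite ltnNge Wd.
Qed.

Lemma column_colors_uniq d : uniq [seq f x | x <- column T d & f x < k].
Proof.
have p : perm_eq (sorted_column T d) (column T d) by rewrite perm_sort.
rewrite -(perm_uniq (perm_map f (perm_filter _ p))).
exact: (colors_uniq vf (column_subseq d) (sort_geq_gtn (uT d))).
Qed.

Lemma column_color_inj d x y : x \in column T d -> y \in column T d ->
  f x = f y -> f x < k -> x = y.
Proof.
move=> xd yd fxy fx.
have /leq_trans : size (color_class f (f x) (sorted_column T d)) <= 1.
  exact: color_class_decreasing vf (column_subseq d) (sort_geq_gtn (uT d)) fx.
have : x \in color_class f (f x) (sorted_column T d) by rewrite mem_filter eqxx mem_sort.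
have : y \in color_class f (f x) (sorted_column T d).
  by rewrite mem_filter -fxy eqxx mem_sort.
case: color_class => [|z [|? ?]] //; first by rewrite !inE => /eqP -> /eqP ->.
by move=> _ _ /(_ 1 isT).
Qed.

Lemma all_colors d i : k <= size (column T d) -> i < k ->
  exists2 x, x \in column T d & f x = i.
Proof.
move=> kd ik; have := weight_f d; rewrite (minn_idPl kd) => e.
have sub : {subset [seq f x | x <- column T d & f x < k] <= iota 0 k}.
  by move=> c /mapP[x + ->]; rewrite mem_filter mem_iota => /andP[].
have sz : size (iota 0 k) <= size [seq f x | x <- column T d & f x < k].
  by rewrite size_iota size_map size_filter -/(weight k f _) e.
have [_ h] := uniq_min_size (column_colors_uniq d) sub sz.
have : i \in iota 0 k by rewrite mem_iota.
by rewrite -h => /mapP[x + ->]; rewrite mem_filter => /andP[_ xd]; exists x.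
Qed.

Lemma all_colored d x : size (column T d) <= k -> x \in column T d -> f x < k.
Proof.
move=> dk xd; have := weight_f d; rewrite (minn_idPr dk) /weight => /eqP.
by rewrite -all_count => /allP; apply.
Qed.

(** The last column of the shortest chosen row. Columns up to [L] have at least [k] cells and so
    contain all colors; column [L.+1] has at most [k] cells, so all its letters are colored. *)
Let L := (row_size T (nth 0 (ranked_rows T) k.-1)).-1.
Let top_size : size top = k.
Proof. by rewrite size_takel // size_ranked_rows. Qed.

Let top_mem c : c \in top -> c < size T.
Proof. by move/mem_take; rewrite mem_ranked_rows. Qed.

Let last_top : nth 0 (ranked_rows T) k.-1 \in top.
Proof.
have kk : k.-1 < k by rewrite prednK.
by rewrite -(nth_take _ kk); apply: mem_nth; rewrite top_size.
Qed.

Let last_cell : is_cell T (nth 0 (ranked_rows T) k.-1) L.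
Proof.
have := ct_cell ctT (top_mem last_top); rewrite /is_cell /L /row_size.
by case: (size _).
Qed.

Let top_cell c : c \in top -> is_cell T c L.
Proof.
move=> ctop; apply: leq_trans last_cell _.
have ik : index c top < k by rewrite -[X in _ < X]top_size index_mem.
have e : nth 0 (ranked_rows T) (index c top) = c by rewrite -(nth_take _ ik) nth_index.
have [h|h] := eqVneq (index c top) k.-1; first by rewrite -h e.
have sk : k.-1 < size (ranked_rows T) by rewrite size_ranked_rows prednK.
have ik1 : index c top < k.-1 by lia.
have /(pairwiseP 0) h' := ranked_rows_sorted T.
have := h' (index c top) k.-1; rewrite !inE (ltn_trans ik1) // => /(_ isT sk ik1).
by rewrite e /row_before /row_size; lia.
Qed.

Let ge_k d : d <= L -> k <= size (column T d).
Proof.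
move=> dL; have /eqP : count (is_cell T ^~ d) top == size top.
  by rewrite -all_count; apply/allP => c /top_cell; exact: leq_ltn_trans.
rewrite top_size size_column_cells => <-.
apply: count_leq_uniq => [|c ctop _]; first exact: take_uniq (uniq_ranked_rows T).
by rewrite mem_iota top_mem.
Qed.

Let le_k : size (column T L.+1) <= k.
Proof.
rewrite size_column_cells -top_size.
apply: leq_trans (count_size (is_cell T ^~ L.+1) top).
apply: count_leq_uniq => [|c]; first exact: iota_uniq.
rewrite mem_iota /= add0n => cT cL; apply: contraTT cL => ctop.
have := take_ranked_before last_top cT ctop; have := last_cell.
by rewrite /is_cell /row_before /L /row_size; lia.
Qed.

Variable v : nat.
Let first_letter i := head 0 (color_class f i w).
Let big_row c := v <= entry T c 0.

Let first_letterE i : i < k -> first_letter i \in column T 0 /\ f (first_letter i) = i.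
Proof.
move=> ik; have [x x0 fx] := all_colors (ge_k (leq0n L)) ik.
have W0 : 0 < W by case/mem_column: x0 => c /wT.
have xc : x \in color_class f i (sorted_column T 0) by rewrite mem_filter fx eqxx mem_sort.
rewrite /first_letter /w (columns_wordE _ W0) color_class_cat color_class_cat.
case E : (color_class f i (sorted_column T 0)) xc => [//|y s] _ /=.
have : y \in color_class f i (sorted_column T 0) by rewrite E inE eqxx.
by rewrite mem_filter mem_sort => /andP[/eqP].
Qed.

(* [reached d c] colors starting at a letter at least [v] have a letter at most
   [c] in column [d]; the rows of [T] starting at least at [v] do not do worse. *)
Let reached d c := count (fun i => (v <= first_letter i) &&
  has (fun x => (f x == i) && (x <= c)) (column T d)) (iota 0 k).
Let reaching d c := count (fun r => [&& big_row r, is_cell T r d & entry T r d <= c])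
  (iota 0 (size T)).

(** The letter of a color in column 0 is its first letter, so both sides compare with the letters of
    that column between [v] and [c]. *)
Let reached0 c : reached 0 c <= reaching 0 c.
Proof.
apply: (@leq_trans (count (fun x => (v <= x) && (x <= c)) (column T 0))); last first.
  rewrite count_column; apply: sub_count => r /= /and3P[rT vr rc].
  by apply/and3P.
apply: leq_trans (count_colors_leq f _ (column T 0) k).
apply: sub_in_count => i; rewrite mem_iota /= add0n => ik /andP[vi /hasP[x x0 /andP[/eqP fx xc]]].
apply/hasP; exists x => //; rewrite fx eqxx xc andbT /=.
have [y0 fy] := first_letterE ik.
by rewrite -(column_color_inj y0 x0 _ _) ?fy ?fx.
Qed.

Let reached_mono d c : d <= L -> reached d.+1 c <= reached d c.
Proof.
move=> dL; apply: sub_in_count => i; rewrite mem_iota /= add0n => ik.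
move=> /andP[-> /hasP[x xd /andP[/eqP fx xc]]] /=.
have [y yd fy] := all_colors (ge_k dL) ik.
apply/hasP; exists y => //; rewrite fy eqxx /=; apply: leq_trans xc.
by apply: ltnW; apply: (column_order (ltnSn d)) => //; rewrite fy.
Qed.

Let head_leq a b : a < size T -> big_row b -> ~~ big_row a -> a < b.
Proof.
move=> aT; rewrite /big_row -ltnNge => vb av; rewrite ltnNge; apply/negP.
rewrite leq_eqVlt => /predU1P[e|ba]; first by rewrite e in vb; lia.
by have := ct_head ctT ba aT; lia.
Qed.

(** Induction on the column, then on [c]. Only an entry [c.+1] of the column, in a row [r], matters.
    If [r] starts at least at [v], the right side gains exactly one and the left side at most one.
    Otherwise [r] lies below all rows starting at least at [v], and the triple condition continues
    each of these whose entry in column [d] is at most [c.+1] by one less than [c.+1]; the bound of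
    the previous column then suffices. *)
Let reached_leq d c : d <= L.+1 -> reached d c <= reaching d c.
Proof.
elim: d c => [|d IHd] c dL; first exact: reached0.
elim: c => [|c IHc].
  apply: (@leq_trans 0) => //; rewrite leqn0 eqn0Ngt -has_count; apply/hasPn => i _.
  rewrite negb_and; apply/orP; right; apply/hasPn => x /mem_column[r rd <-].
  by rewrite negb_and -ltnNge (leq_ltn_trans _ (ct_row ctT rd)) ?orbT.
have [/mem_column[r rd er]|nc] := boolP (c.+1 \in column T d.+1); last first.
  apply: (@leq_trans (reached d.+1 c)).
    apply: sub_count => i /andP[-> /hasP[x xd /andP[fx xc]]] /=.
    apply/hasP; exists x; rewrite // fx -ltnS ltn_neqAle xc andbT.
    by apply: contraNneq nc => <-.
  apply: leq_trans IHc _; apply: sub_count => a /and3P[-> -> h] /=; exact: leqW.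
have rT := is_cell_size rd.
have [br|nbr] := boolP (big_row r).
  apply: (@leq_trans (reached d.+1 c).+1).
    rewrite -[(reached _ _).+1]addn1; have h : count (pred1 (f c.+1)) (iota 0 k) <= 1.
      by rewrite count_uniq_mem ?iota_uniq // leq_b1.
    apply: leq_trans (leq_add (leqnn _) h); apply: leq_trans (count_or_leq _ _ _).
    apply: sub_count => i /andP[-> /hasP[x xd /andP[fx xc]]] /=.
    have [e|ne] := eqVneq x c.+1; first by rewrite e in fx; rewrite eq_sym fx orbT.
    apply/orP; left; apply/hasP; exists x => //.
    by rewrite fx -ltnS ltn_neqAle ne.
  apply: leq_ltn_trans IHc _.
  rewrite /reaching -!size_filter.
  have sub : {subset r :: [seq a <- iota 0 (size T) |
       [&& big_row a, is_cell T a d.+1 & entry T a d.+1 <= c]]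
     <= [seq a <- iota 0 (size T) |
       [&& big_row a, is_cell T a d.+1 & entry T a d.+1 <= c.+1]]}.
    move=> a; rewrite inE => /predU1P[->|].
      by rewrite mem_filter mem_iota br rd er leqnn /= rT.
    rewrite !mem_filter => /andP[/and3P[-> -> h] ->] /=; by rewrite leqW.
  apply: (uniq_leq_size _ sub) => /=.
  by rewrite filter_uniq ?iota_uniq // mem_filter er ltnn !andbF.
apply: leq_trans (reached_mono c.+1 (dL : d <= L)) _.
apply: leq_trans (IHd c.+1 (ltnW dL)) _.
apply: sub_count => a /and3P[ba ad ac] /=; rewrite ba /=.
rewrite -er in ac; have [h1 h2] := ct_triple ctT (head_leq rT ba nbr) rd ad ac.
by rewrite h1 ltnW // -er.
Qed.

Let big_colors := count (fun i => v <= first_letter i) (iota 0 k).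

Let big_colors_leq : big_colors <= count (fun r => big_row r && is_cell T r L) (iota 0 (size T)).
Proof.
have := reached_leq (\max_(x <- column T L) x) (leqnSn L).
move=> h; apply: leq_trans (leq_trans h _); last first.
  by apply: sub_count => r /and3P[-> ->].
apply: sub_in_count => i; rewrite mem_iota /= add0n => ik -> /=.
have [x xL fx] := all_colors (ge_k (leqnn L)) ik.
by apply/hasP; exists x; rewrite // fx eqxx /=; exact: leq_bigmax_seq.
Qed.

(** The letters of column [L.+1] have distinct colors. Those starting at least at [v] are no more
    numerous than the cells in rows starting at least at [v], so the remaining cells are outnumbered
    by the colors starting below [v], of which there are [k - big_colors]. *)
Let small_rows_leq :
  count (fun r => ~~ big_row r && is_cell T r L.+1) (iota 0 (size T)) + big_colors <= k.
Proof.
set M := \max_(x <- column T L.+1) x.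
pose appears i := has (fun x => f x == i) (column T L.+1).
have h1 : size (column T L.+1) <= count appears (iota 0 k).
  have -> : size (column T L.+1) = size [seq f x | x <- column T L.+1 & f x < k].
    rewrite size_map; congr size; symmetry; apply/all_filterP/allP => x xL.
    exact: all_colored le_k xL.
  rewrite -size_filter; apply: uniq_leq_size (column_colors_uniq _) _ => i /mapP[x xL ->].
  have /andP[fx xC] : (f x < k) && (x \in column T L.+1)
    by rewrite -(mem_filter (fun y => f y < k)).
  by rewrite mem_filter mem_iota /= add0n fx andbT; apply/hasP; exists x.
have h2 : count (fun i => (v <= first_letter i) && appears i) (iota 0 k) <=
    count (fun r => big_row r && is_cell T r L.+1) (iota 0 (size T)).
  apply: leq_trans (leq_trans (reached_leq M (leqnn _)) _); last first.
    by apply: sub_count => r /and3P[-> ->].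
  apply: sub_count => i /andP[-> /hasP[x xL fx]] /=; apply/hasP; exists x => //.
  by rewrite fx; exact: leq_bigmax_seq.
have split (p q : pred nat) s :
    count q s = count (fun i => p i && q i) s + count (fun i => ~~ p i && q i) s.
  by rewrite -(size_filter q) -(count_predC p) !count_filter.
rewrite size_column_cells (split big_row) (split (fun i => v <= first_letter i) appears) /= in h1.
have h3 : count (fun i => ~~ (v <= first_letter i) && appears i) (iota 0 k) + big_colors <= k.
  have := count_predC (fun i => v <= first_letter i) (iota 0 k).
  rewrite size_iota -/big_colors => e; rewrite -[X in _ <= X]e addnC leq_add2l.
  by apply: sub_count => i /andP[].
move: (leq_trans h1 (leq_add h2 (leqnn _))); rewrite leq_add2l => h4.
by apply: leq_trans h3; rewrite leq_add2r.
Qed.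

(** If every row that starts at least at [v] and reaches column [L] is chosen, [big_colors_leq]
    suffices. Otherwise let [r] be one left out. A chosen row starting below [v] lies below [r] and
    yet is ranked before it; as ties favor upper rows, it is strictly longer and reaches column
    [L.+1]. Then [small_rows_leq] bounds the number of such rows. *)
Lemma heads_dominated :
  count (fun i => v <= head 0 (color_class f i w)) (iota 0 k) <=
  count (fun c => v <= entry T c 0) (take k (ranked_rows T)).
Proof.
rewrite -/big_colors -/top.
have [/allP h|/allPn[r]]
  := boolP (all (mem top) [seq r <- iota 0 (size T) | big_row r && is_cell T r L]).
  apply: leq_trans big_colors_leq _.
  apply: leq_trans (count_leq_uniq (t := top) (iota_uniq _ _) _) _.
    by move=> r rT rb; apply: h; rewrite mem_filter rb.
  by apply: sub_count => r /andP[].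
rewrite mem_filter mem_iota /= add0n => /andP[/andP[br rL] rT] rtop.
have : count (fun c => ~~ big_row c) top <=
    count (fun c => ~~ big_row c && is_cell T c L.+1) (iota 0 (size T)).
  apply: (@leq_trans (count (fun c => ~~ big_row c && is_cell T c L.+1) top)); last first.
    apply: count_leq_uniq => [|c /top_mem cT _]; last by rewrite mem_iota.
    exact: take_uniq (uniq_ranked_rows T).
  apply: sub_in_count => c ctop nbc; rewrite nbc /=.
  have := take_ranked_before ctop rT rtop; rewrite /row_before => /orP[h|/andP[_ rc]].
    by apply: leq_trans h; exact: rL.
  have := head_leq (top_mem ctop) br nbc; lia.
move=> h; rewrite -(leq_add2r (count (fun c => ~~ big_row c) top)).
have -> : count (fun c => v <= entry T c 0) top + count (fun c => ~~ big_row c) top = k.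
  by rewrite -[RHS]top_size -(count_predC big_row top).
by apply: leq_trans small_rows_leq; rewrite addnC leq_add2r.
Qed.

End HeadsDominated.

(** * Optimal colorings of the column word and of the inserted word *)

Lemma eq_sum_leq W (F G : nat -> nat) : (forall d, F d <= G d) ->
  \sum_(0 <= d < W) F d = \sum_(0 <= d < W) G d -> forall d, d < W -> F d = G d.
Proof.
move=> FG; elim: W => [//|W IH]; rewrite !big_nat_recr //= => e d.
have le : \sum_(0 <= d < W) F d <= \sum_(0 <= d < W) G d by apply: leq_sum.
have [e1 e2] : \sum_(0 <= d < W) F d = \sum_(0 <= d < W) G d /\ F W = G W.
  by have := FG W; move: (bigop _ _ _) (bigop _ _ _) le e => a b; lia.
by rewrite ltnS leq_eqVlt => /predU1P[->|] //; exact: IH.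
Qed.

Definition count_heads (k : nat) (f : nat -> nat) (w : seq nat) (v : nat) : nat :=
  count (fun i => v <= head 0 (color_class f i w)) (iota 0 k).

Lemma count_columns_word p (g : nat -> seq nat) W :
  count p (columns_word g W) = \sum_(0 <= d < W) count p (g d).
Proof. by rewrite count_flatten sumnE !big_map /index_iota subn0. Qed.

Section CompositionTableauOptimum.

Variables (T : tableau) (W : nat).
Let w := columns_word (sorted_column T) W.
Hypotheses (ctT : composition_tableau T) (wT : width_at_most W T) (uw : uniq w).

Let rows_short : all (fun r => size r <= W) T.
Proof.
apply/(all_nthP [::]) => c cT; rewrite leqNgt; apply/negP => h.
by have := wT (h : is_cell T c W); rewrite ltnn.
Qed.

Let perm_w : perm_eq w (flatten T).
Proof.
apply/seq.permP => p; rewrite (count_flatten_columns _ rows_short) count_columns_word.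
by apply: eq_bigr => d _; rewrite (seq.permP (permEl (perm_sort _ _))).
Qed.

Let rows_sorted : all (sorted ltn) T.
Proof.
apply/(all_nthP [::]) => c cT; apply/(sortedP 0) => d; exact: (ct_row ctT).
Qed.

Let wide_column d : W <= d -> column T d = [::].
Proof.
move=> Wd; case E : (column T d) => [//|x s]; have : x \in column T d by rewrite E inE eqxx.
by case/mem_column => c /wT; rewrite ltnNge Wd.
Qed.

Let uniq_columns d : uniq (column T d).
Proof.
have [dW|/wide_column -> //] := ltnP d W.
by move: uw; rewrite /w (columns_wordE _ dW) !cat_uniq sort_uniq => /and3P[_ _ /andP[]].
Qed.

Let rows_subseq : {in T, forall r, subseq r w}.
Proof.
move=> r /(nthP [::])[c cT <-]; set s := nth _ _ _.
have sW : size s <= W by exact: (all_nthP [::] rows_short).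
rewrite -(mkseq_nth 0 s) /mkseq /w /columns_word -{1}(subnKC sW) iotaD map_cat flatten_cat.
apply: subseq_trans (prefix_subseq _ _).
have : {in iota 0 (size s), forall d, nth 0 s d \in sorted_column T d}.
  move=> d; rewrite mem_iota /= add0n => ds.
  by rewrite mem_sort; apply/mem_column; exists c.
elim: (iota 0 (size s)) => //= d l IH h; rewrite -cat1s.
apply: cat_subseq; first by rewrite sub1seq h ?inE ?eqxx.
by apply: IH => e el; apply: h; rewrite inE el orbT.
Qed.

Let rank_sum k : sumn (take k (ranked_sizes T)) =
  \sum_(0 <= d < W) minn k (count (ltn d) (shape T)).
Proof.
rewrite (@sumn_take_sorted _ _ W (ranked_sizes_sorted T)).
  by apply: eq_bigr => d _; rewrite (seq.permP (perm_ranked_sizes T)).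
by rewrite (perm_all _ (perm_ranked_sizes T)) all_map.
Qed.

Lemma columns_word_weight k f : valid_coloring k f w ->
  weight k f w <= sumn (take k (ranked_sizes T)).
Proof.
move=> vf; rewrite rank_sum; apply: weight_columns vf perm_w rows_short _ => d.
exists (sorted_column T d); split.
- by rewrite perm_sort.
- exact: column_subseq.
- exact: sort_geq_gtn.
Qed.

Lemma columns_word_row_coloring k : let rows := take k (ranked_rows T) in
  let f := row_coloring T rows k in
  [/\ valid_coloring k f w, weight k f w = sumn (take k (ranked_sizes T))
    & forall i, i < size rows -> head 0 (color_class f i w) = entry T (nth 0 rows i) 0].
Proof.
move=> rows f.
have ur : uniq rows by exact: take_uniq (uniq_ranked_rows T).
have rT : {in rows, forall c, c < size T} by move=> c /mem_take; rewrite mem_ranked_rows.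
have sr : size rows <= k by rewrite size_take; case: ltnP => // /ltnW.
split.
- exact: valid_row_coloring.
- rewrite weight_row_coloring //; congr sumn.
  by rewrite /ranked_sizes -map_take.
- move=> i ir; rewrite color_class_row_coloring //; last exact: leq_trans ir sr.
  by rewrite ir /entry nth0.
Qed.

(** The optimal weight is the sum of the bounds for the single columns, so each of these bounds is
    attained. *)
Lemma columns_word_heads k f v : k <= size T -> valid_coloring k f w ->
  weight k f w = sumn (take k (ranked_sizes T)) ->
  count_heads k f w v <= count (fun c => v <= entry T c 0) (take k (ranked_rows T)).
Proof.
case: k => [//|k] kT vf; rewrite rank_sum /weight (seq.permP perm_w).
rewrite (count_flatten_columns _ rows_short) => e.
apply: heads_dominated => // d.
have [dW|/wide_column ->] := ltnP d W; last by rewrite minn0.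
rewrite size_column; apply: (eq_sum_leq _ e dW) => {dW}d.
rewrite -size_column /= -(seq.permP (permEl (perm_sort geq _))).
rewrite -[X in minn _ X](perm_size (permEl (perm_sort geq _))).
apply: (weight_decreasing vf); first exact: column_subseq.
exact: sort_geq_gtn.
Qed.

End CompositionTableauOptimum.

Section YCOptimum.

Variable w : seq nat.
Hypothesis uw : uniq w.
Let T := YC_tableau w.
Let w0 := columns_word (sorted_column T) (size w).+1.

Let kw : knuth w0 w.
Proof. by have [_ _] := YC_tableau_spec uw; apply. Qed.

Let uw0 : uniq w0. Proof. by rewrite (perm_uniq (knuth_perm kw)). Qed.

Let ctT : composition_tableau T. Proof. by have [] := YC_tableau_spec uw. Qed.

Let wT : width_at_most (size w).+1 T.
Proof. by have [_ h _] := YC_tableau_spec uw => c d /h /ltnW. Qed.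

Lemma YC_weight k f : valid_coloring k f w -> weight k f w <= sumn (take k (ranked_sizes T)).
Proof.
have [_ s] := knuth_simulates k kw uw0.
by move=> /s[f' [vf' <- _]]; exact: columns_word_weight.
Qed.

Lemma YC_heads k f v : k <= size T -> valid_coloring k f w ->
  weight k f w = sumn (take k (ranked_sizes T)) ->
  count_heads k f w v <= count (fun c => v <= entry T c 0) (take k (ranked_rows T)).
Proof.
have [_ s] := knuth_simulates k kw uw0.
move=> kT /s[f' [vf' <- h]] e; apply: leq_trans (columns_word_heads ctT wT uw0 v kT vf' e).
apply: sub_in_count => i; rewrite mem_iota /= add0n => ik vi.
exact: leq_trans vi (h i ik).
Qed.

(** Carrying the coloring by rows over to [w] can only raise first entries, and [YC_heads] forbids
    more of them above any threshold; hence the equality of all counts. *)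
Lemma YC_optimal_coloring k : exists f, [/\ valid_coloring k f w,
    weight k f w = sumn (take k (ranked_sizes T))
  & k <= size T -> forall v, count_heads k f w v =
      count (fun c => v <= entry T c 0) (take k (ranked_rows T))].
Proof.
have [vf0 wf0 hf0] := columns_word_row_coloring ctT wT uw0 k.
have [s _] := knuth_simulates k kw uw0.
have [f [vf wf hf]] := s _ vf0; exists f; split=> //; first by rewrite wf.
move=> kT v; apply/eqP; rewrite eqn_leq YC_heads //=; last by rewrite wf.
have sr : size (take k (ranked_rows T)) = k by rewrite size_takel // size_ranked_rows.
rewrite -{1}(mkseq_nth 0 (take k _)) sr /mkseq count_map.
apply: sub_in_count => i; rewrite mem_iota /= add0n => ik.
by rewrite -hf0 ?sr // => h; exact: leq_trans h (hf i ik).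
Qed.

End YCOptimum.

(** * The Robinson-Schensted shape and decreasing subsequences *)

Lemma standard_column T d : standard T ->
  sorted ltn (column T d) /\ (size (head [::] T) <= d -> column T d = [::]).
Proof.
elim: T => [//|r T IH] /= [sr r0 [dm1 dm2] /IH [sT nT]].
rewrite column_cons; case: ltnP => dr; last first.
  by rewrite nT //; exact: leq_trans dm1 dr.
split=> // ; case: T dm1 dm2 sT nT {IH} => [|r' T] //= dm1 dm2.
rewrite column_cons; case: ltnP => dr' sT nT; last by rewrite nT.
by rewrite /= dm2.
Qed.

Lemma standard_shape T : standard T -> sorted geq (shape T).
Proof.
elim: T => [//|r T IH] /= [_ _ [dm _] /IH]; case: T dm {IH} => [|r' T] //= dm ->.
by rewrite andbT.
Qed.

Lemma column_row_word T d : subseq (rev (column T d)) (row_word T).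
Proof.
elim: T => [//|r T IH] /=; rewrite column_cons; case: ifP => dr.
  by rewrite rev_cons -cats1; apply: cat_subseq => //; rewrite sub1seq mem_nth.
by apply: subseq_trans IH _; exact: prefix_subseq.
Qed.

Lemma row_row_word T : {in T, forall r, subseq r (row_word T)}.
Proof.
elim: T => [//|r T IH] r' /=; rewrite inE => /predU1P[->|/IH h]; first exact: suffix_subseq.
by apply: subseq_trans h _; exact: prefix_subseq.
Qed.

Lemma standard_rows T : standard T -> all (sorted ltn) T && all (fun r => 0 < size r) T.
Proof. by elim: T => //= r T IH [-> -> _ /IH]. Qed.

Section RSOptimum.

Variable w : seq nat.
Hypothesis uw : uniq w.
Let T := RS_tableau w.

Let sT : standard T. Proof. by have [] := RS_tableau_spec uw. Qed.
Let kw : knuth (row_word T) w. Proof. by have [] := RS_tableau_spec uw. Qed.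
Let uT : uniq (row_word T). Proof. by rewrite (perm_uniq (knuth_perm kw)). Qed.

Let bounded : all (fun r => size r <= size w) T.
Proof.
apply/allP => r rT; rewrite -(perm_size (knuth_perm kw)).
by apply: size_subseq; exact: row_row_word.
Qed.

Lemma RS_weight k f : valid_coloring k f w -> weight k f w <= sumn (take k (shape T)).
Proof.
have [_ s] := knuth_simulates k kw uT; move=> /s[f' [vf' <- _]].
rewrite (@sumn_take_sorted _ _ (size w) (standard_shape sT)); last by rewrite all_map.
apply: weight_columns vf' (perm_row_word T) bounded _ => d.
exists (rev (column T d)); split; first by rewrite perm_rev.
- exact: column_row_word.
- rewrite -sorted_pairwise; last by move=> y x z /= xy yz; apply: ltn_trans yz xy.
  by rewrite rev_sorted; have [] := standard_column d sT.
Qed.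

Lemma RS_optimal_coloring k : exists2 f, valid_coloring k f w &
  weight k f w = sumn (take k (shape T)).
Proof.
pose rows := take k (iota 0 (size T)).
have ur : uniq rows by exact: take_uniq (iota_uniq _ _).
have rT : {in rows, forall c, c < size T} by move=> c /mem_take; rewrite mem_iota.
have sr : size rows <= k by rewrite size_take; case: ltnP => // /ltnW.
have sorted_rows : all (sorted ltn) T by case/andP: (standard_rows sT).
have pT := perm_row_word T; have sub := @row_row_word T.
have [s _] := knuth_simulates k kw uT.
have [f [vf wf _]] := s _ (valid_row_coloring uT pT sorted_rows sub ur rT sr).
exists f => //; rewrite wf weight_row_coloring // -map_take; congr sumn.
by rewrite /shape map_take -{2}(mkseq_nth [::] T) /mkseq -map_comp -map_take.
Qed.

End RSOptimum.

Lemma eq_of_partial_sums (s t : seq nat) : all (leq 1) s -> all (leq 1) t ->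
  (forall k, sumn (take k s) = sumn (take k t)) -> s = t.
Proof.
elim: s t => [|x s IH] [|y t] //=.
- by move=> _ /andP[y0 _] /(_ 1) /=; lia.
- by move=> /andP[x0 _] _ /(_ 1) /=; lia.
move=> /andP[_ s0] /andP[_ t0] h; have := h 1; rewrite /= !take0 !addn0 => xy.
by rewrite xy; congr (_ :: _); apply: IH => // k; have := h k.+1; rewrite /= xy => /addnI.
Qed.

(** On both sides the sum of the first [k] parts is the largest weight of a valid coloring of [w],
    and sequences of positive parts are determined by these sums. *)
Lemma RS_shape w : uniq w -> shape (RS_tableau w) = ranked_sizes (YC_tableau w).
Proof.
move=> uw; apply: eq_of_partial_sums => [||k].
- by rewrite all_map; case/andP: (standard_rows (proj1 (RS_tableau_spec uw))).
- rewrite all_map; apply/allP => c; rewrite mem_ranked_rows => cT /=.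
  by have [ctT _ _] := YC_tableau_spec uw; exact: (ct_cell ctT).
have [f vf wf] := RS_optimal_coloring uw k.
have [g [vg wg _]] := YC_optimal_coloring uw k.
by apply/eqP; rewrite eqn_leq -{1}wf YC_weight //= -wg RS_weight.
Qed.

(** * Unions of increasing subsequences and bounded decreasing ones *)

Fixpoint nonmaxima (m : nat) (s : seq nat) : seq nat :=
  if s is x :: s' then if m <= x then nonmaxima x s' else x :: nonmaxima m s' else [::].

Fixpoint maxima (m : nat) (s : seq nat) : seq nat :=
  if s is x :: s' then if m <= x then x :: maxima x s' else maxima m s' else [::].

Lemma nonmaxima_subseq m s : subseq (nonmaxima m s) s.
Proof.
elim: s m => // x s IH m; rewrite [nonmaxima _ _]/=; case: ifP => _; last by rewrite /= eqxx.
by apply: subseq_trans (IH x) _; exact: subseq_cons.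
Qed.

Lemma maxima_filter m s : uniq s -> [seq x <- s | x \notin nonmaxima m s] = maxima m s.
Proof.
elim: s m => //= x s IH m /andP[xs us]; case: (leqP m x) => mx.
  have -> : x \notin nonmaxima x s by apply/negP => /(mem_subseq (nonmaxima_subseq x s)) /(negP xs).
  by rewrite IH.
rewrite inE eqxx /= -(IH m us); apply: eq_in_filter => y ys.
by rewrite inE negb_or; case: eqP => // e; rewrite -e ys in xs.
Qed.

Lemma maxima_path m s : path leq m (maxima m s).
Proof. by elim: s m => //= x s IH m; case: ifP => //= ->; exact: IH. Qed.

(** The running maximum that rules out [y] is either the initial threshold or an earlier letter of
    [s]. For [m = 0] the first case is void, and a decreasing sequence of nonmaxima extends by one
    letter in front. *)
Lemma nonmaxima_extend m s y d : subseq (y :: d) (nonmaxima m s) ->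
  y < m \/ exists2 z, y < z & subseq [:: z, y & d] s.
Proof.
elim: s m => [//|x s IH] m; rewrite [nonmaxima _ _]/=; case: (leqP m x) => mx h.
  right; case: (IH x h) => [yx|[z yz sz]].
    by exists x; rewrite //= eqxx; exact: subseq_trans h (nonmaxima_subseq _ _).
  by exists z => //; apply: subseq_trans sz _; exact: subseq_cons.
move: h; rewrite [subseq _ _]/=; have [e|_] := eqVneq x y; first by left; rewrite -e.
move=> /IH[ym|[z yz sz]]; first by left.
by right; exists z => //; apply: subseq_trans sz _; exact: subseq_cons.
Qed.

Lemma k_increasingP k s : reflect
  (forall d, subseq d s -> sorted gtn d -> size d != k.+1) (k_increasing k s).
Proof.
apply: (iffP existsPn) => [h d /subseqP[m sm ->] gd|h m].
  by have := h (Tuple (introT eqP sm)); rewrite /= gd.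
apply/negP => /andP[gm]; apply/negP; apply: h => //; exact: mask_subseq.
Qed.

(* The left-to-right maxima are increasing, and every other letter has a larger one
   before it: removing them shortens all decreasing subsequences. *)
Lemma k_increasing_coloring k s : uniq s -> k_increasing k s ->
  exists2 f, valid_coloring k f s & {in s, forall x, f x < k}.
Proof.
elim: k s => [|k IH] s us /k_increasingP h.
  exists id => // x xs; have := h [:: x]; rewrite sub1seq xs => /(_ isT isT).
  by rewrite eqxx.
have ssub := nonmaxima_subseq 0 s.
have [|g vg gk] := IH (nonmaxima 0 s) (subseq_uniq ssub us).
  apply/k_increasingP => [[|y d]] // sd gd.
  case: (nonmaxima_extend sd) => [//|[z yz sz]].
  have := h _ sz; rewrite /= in gd *; rewrite yz => /(_ gd).
  by rewrite eqSS.
pose f x := if x \in nonmaxima 0 s then g x else k.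
exists f => [i|x xs]; last by rewrite /f; case: ifP => // /gk /ltnW.
rewrite ltnS leq_eqVlt => /predU1P[->|ik].
  have -> : color_class f k s = maxima 0 s.
    rewrite -maxima_filter //; apply: eq_in_filter => x xs; rewrite /f.
    by case: ifP => [/gk /ltn_eqF|]; rewrite ?eqxx.
  rewrite ltn_sorted_uniq_leq -{1}(maxima_filter 0 us) filter_uniq //=.
  exact: path_sorted (maxima_path 0 s).
have -> : color_class f i s = color_class g i (nonmaxima 0 s).
  rewrite (subseq_uniqP us ssub) /color_class -filter_predI.
  apply: eq_in_filter => x xs; rewrite /f /=; case: ifP => _; rewrite ?andbT //.
  by rewrite andbF gtn_eqF.
exact: vg.
Qed.

Lemma max_k_increasing_eq k w M : uniq w ->
  (forall f, valid_coloring k f w -> weight k f w <= M) ->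
  (exists2 f, valid_coloring k f w & weight k f w = M) ->
  max_k_increasing k w = M.
Proof.
move=> uw bound [f vf wf]; apply/eqP; rewrite eqn_leq; apply/andP; split.
  apply/bigmax_leqP => m inc; have uM : uniq (mask m w) by exact: mask_uniq.
  have [g vg gk] := k_increasing_coloring uM inc.
  pose h x := if x \in mask m w then g x else k.
  have cE p : p k = false -> [seq x <- w | p (h x)] = [seq x <- mask m w | p (g x)].
    move=> pk; have sm := mask_subseq m w.
    rewrite (subseq_uniqP uw sm) -filter_predI; apply: eq_in_filter => x xs.
    by rewrite /h /=; case: ifP => _; rewrite ?andbT // andbF.
  have vh : valid_coloring k h w.
    by move=> i ik; rewrite /color_class (cE (eq_op^~ i)) ?gtn_eqF //; exact: vg.
  apply: leq_trans (bound h vh); rewrite /weight -size_filter (cE (ltn^~ k)); last exact: ltnn.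
  by rewrite (all_filterP (introT allP gk)).
pose m : (size w).-tuple bool := map_tuple (fun x => f x < k) (in_tuple w).
have mE : mask m w = [seq x <- w | f x < k] by rewrite filter_mask.
have <- : size (mask m w) = M by rewrite mE size_filter.
apply: (leq_bigmax_cond (F := fun m : (size w).-tuple bool => size (mask m w))).
rewrite mE; apply/k_increasingP => d sd gd; rewrite neq_ltn ltnS; apply/orP; left.
have tr : transitive gtn by move=> y x z /= xy yz; apply: ltn_trans yz xy.
rewrite (sorted_pairwise tr) in gd.
have sdw := subseq_trans sd (filter_subseq _ _).
(* All letters of [d] are colored, so its weight is its length. *)
have := weight_decreasing vf sdw gd; rewrite leq_min => /andP[+ _].
suff -> : weight k f d = size d by [].
apply/eqP; rewrite -all_count; apply/allP => x /(mem_subseq sd).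
by rewrite mem_filter => /andP[].
Qed.

(** * The maximal sets of first entries *)

(** At the first difference, suppose the entry [x] of [a] exceeds that of [b]: the threshold [x]
    then counts all that remains of [a], but misses a letter of [b]. *)
Lemma sorted_dominated_lex (a b : seq nat) : sorted leq a -> sorted leq b -> size a = size b ->
  (forall v, count (leq v) a <= count (leq v) b) ->
  a = b \/ exists i, [/\ i < size a, forall j, j < i -> nth 0 a j = nth 0 b j
    & nth 0 a i < nth 0 b i].
Proof.
elim: a b => [|x a IH] [|y b] //=; first by left.
move=> sa sb [sab] h.
have [xy|yx|xy] := ltngtP x y; first by right; exists 0; split.
  have := h x; rewrite leqnn (leqNgt x y) yx /=.
  have -> : count (leq x) a = size a.
    by apply/eqP; rewrite -all_count; apply: order_path_min sa; exact: leq_trans.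
  by move=> /leq_trans /(_ (count_size _ _)); rewrite sab add1n ltnn.
subst y; have [||//|v|->|[i [ia ij iab]]] := IH b.
- exact: path_sorted sa.
- exact: path_sorted sb.
- by have := h v; rewrite leq_add2l.
- by left.
by right; exists i.+1; split=> // -[|j] //=; exact: ij.
Qed.

Lemma le_set_dominated (A B : {fset nat}) :
  (forall v, count (leq v) A <= count (leq v) B) -> le_set A B.
Proof.
move=> h; rewrite /le_set.
have := h 0; rewrite !(eq_count (a1 := leq 0) (a2 := predT)) // !count_predT => sAB.
move: sAB; rewrite leq_eqVlt => /orP[/eqP sAB|->] //.
have pA := permEl (perm_sort leq A); have pB := permEl (perm_sort leq B).
have [||||e|[i [iA ij iAB]]] := @sorted_dominated_lex (sort leq A) (sort leq B).
- exact: (sort_sorted leq_total).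
- exact: (sort_sorted leq_total).
- by rewrite !size_sort.
- by move=> v; rewrite (seq.permP pA) (seq.permP pB).
- suff -> : A == B by rewrite orbT.
  by apply/eqP/fsetP => x; rewrite -(perm_mem pA) -(perm_mem pB) e.
apply/orP; right; apply/orP; right; rewrite sAB eqxx /=.
rewrite size_sort sAB in iA; apply/existsP; exists (Ordinal iA) => /=; rewrite iAB andbT.
by apply/forallP => j; apply/implyP => ji; rewrite ij.
Qed.

Lemma le_set_anti A B : le_set A B -> le_set B A -> A = B.
Proof.
rewrite /le_set; have [->//|_ /=] := eqVneq A B.
move=> /orP[h1|/andP[/eqP e /existsP[i /andP[/forallP ij iAB]]]].
  by rewrite ltnNge (ltnW h1) /= eq_sym (ltn_eqF h1).
move=> /orP[|/andP[_ /existsP[j /andP[/forallP ji jBA]]]]; first by rewrite e ltnn.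
have jA : j < #|`A| by rewrite e.
have iB : i < #|`B| by rewrite -e.
have := ji (Ordinal iB); have := ij (Ordinal jA); rewrite /=.
case: (ltngtP i j) => [h _ /eqP h'|h /eqP h' _|h _ _].
- by move: iAB; rewrite h' ltnn.
- by move: jBA; rewrite h' ltnn.
- by move: iAB jBA; rewrite h => /ltnW; rewrite leqNgt => /negbTE ->.
Qed.

(** Partial maxima stay below [S]; once [S] occurs it is kept, since a partial maximum that is also
    above [S] equals it by antisymmetry. *)
Lemma big_max_set (I : finType) (P : pred I) (F : I -> {fset nat}) S :
  (forall i, P i -> le_set (F i) S) -> (exists2 i, P i & F i = S) ->
  \big[max_set/fset0]_(i | P i) F i = S.
Proof.
move=> FS [i0 Pi0 Fi0].
have le0 : le_set fset0 S.
  rewrite /le_set cardfs0; case: (posnP #|`S|) => [/eqP|] //.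
  by rewrite cardfs_eq0 => /eqP ->; rewrite eqxx orbT.
have le (r : seq I) : le_set (\big[max_set/fset0]_(i <- r | P i) F i) S.
  elim/big_ind: _ => // x y xS yS; rewrite /max_set; case: ifP => //.
have : i0 \in index_enum I by exact: mem_index_enum.
elim: (index_enum I) => [//|i r IH]; rewrite inE big_cons => /predU1P[<-|/IH ->].
  rewrite Pi0 Fi0 /max_set; case: ifP => // h; exact: le_set_anti (le r) h.
case: ifP => // Pi; rewrite /max_set FS //.
Qed.

Lemma perm_fset (s : seq nat) : uniq s -> perm_eq [fset x in s] s.
Proof.
by move=> us; apply: uniq_perm (fset_uniq _) us _ => x; rewrite !inE.
Qed.

Lemma count_pmap_head v (us : seq (seq nat)) : 0 < v ->
  count (leq v) (pmap ohead us) = count (fun u => v <= head 0 u) us.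
Proof.
move=> v0; elim: us => [//|[|x u] us IH] /=; last by rewrite IH.
by rewrite IH leqNgt v0.
Qed.

Definition color_classes (k : nat) (f : nat -> nat) (w : seq nat) : seq (seq nat) :=
  [seq color_class f i w | i <- iota 0 k].

Lemma uniq_heads k f w : uniq (pmap ohead (color_classes k f w)).
Proof.
rewrite /color_classes; elim: (iota 0 k) (iota_uniq 0 k) => //= i l IH /andP[il /IH ul].
case E : (color_class f i w) => [|x u] //=; rewrite ul andbT.
rewrite mem_pmap; apply/mapP => [[_ /mapP[j jl ->] e]].
have fx a : Some x = ohead (color_class f a w) -> f x = a.
  case E' : color_class => [//|y u'] [->].
  have : y \in color_class f a w by rewrite E' inE eqxx.
  by rewrite mem_filter => /andP[/eqP].
by rewrite -(fx i) ?E // (fx j e) jl in il.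
Qed.

(** Threshold 0 is raised to 1: this changes nothing for a set of positive letters, but avoids
    counting empty classes, whose default head is 0. *)
Lemma count_IES k f w v : {in w, forall x, 0 < x} ->
  count (leq v) (IES (color_classes k f w)) = count_heads k f w (maxn v 1).
Proof.
move=> w0; rewrite (seq.permP (perm_fset (uniq_heads k f w))).
have e : {in pmap ohead (color_classes k f w), forall x, (v <= x) = (maxn v 1 <= x)}.
  move=> x; rewrite mem_pmap => /mapP[_ /mapP[j _ ->] e]; rewrite geq_max.
  suff -> : 1 <= x by rewrite andbT.
  apply: w0; have : x \in color_class f j w.
    by case: (color_class _ _ _) e => // y s [->]; rewrite inE eqxx.
  by rewrite mem_filter => /andP[].
by rewrite (eq_in_count e) count_pmap_head ?leq_maxr // count_map.
Qed.

Lemma subseq_color_class f i w : subseq (color_class f i w) w.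
Proof. exact: filter_subseq. Qed.

Lemma in_Inc_coloring k w (u : k.-tuple (seq nat)) : uniq w -> in_Inc w u ->
  exists f, [/\ valid_coloring k f w, weight k f w = max_k_increasing k w
    & u = color_classes k f w :> seq _].
Proof.
move=> uw /and3P[/forallP h1 /forallP h2 /eqP h3].
pose f x := find (fun s => x \in s) u.
have fE (i : 'I_k) x : (f x == i) = (x \in tnth u i).
  apply/eqP/idP => [e|xi].
    rewrite (tnth_nth [::]) -e; apply: (nth_find [::] (a := fun s => x \in s)).
    by rewrite has_find -/(f x) e size_tuple.
  have hx : has (fun s => x \in s) u by apply/hasP; exists (tnth u i) => //; exact: mem_tnth.
  have fk : f x < k by rewrite -(size_tuple u) /f -has_find.
  have xf : x \in tnth u (Ordinal fk) by rewrite (tnth_nth [::]);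
    exact: (nth_find [::] (a := fun s => x \in s) hx).
  have [->//|ne] := eqVneq i (Ordinal fk).
  by have /forallP/(_ (Ordinal fk)) := h2 i; rewrite ne /= => /hasPn/(_ x xf); rewrite /= xi.
have cE (i : 'I_k) : color_class f i w = tnth u i.
  have /andP[si _] := h1 i; rewrite [RHS](subseq_uniqP uw si).
  by apply: eq_filter => x; exact: fE.
exists f; split.
- by move=> i ik; rewrite (cE (Ordinal ik)); have /andP[] := h1 (Ordinal ik).
- by rewrite weight_sum big_mkord -h3; apply: eq_bigr => i _; rewrite cE.
- apply: (@eq_from_nth _ [::]); first by rewrite size_map size_iota size_tuple.
  move=> i; rewrite size_tuple => ik; rewrite (nth_map 0) ?size_iota // nth_iota // add0n.
  by rewrite (cE (Ordinal ik)) (tnth_nth [::]).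
Qed.

Lemma coloring_in_Inc k w f : valid_coloring k f w ->
  weight k f w = max_k_increasing k w ->
  exists2 u : k.-tuple ((size w).-tuple bool),
    in_Inc w [tuple of [seq mask (tval m) w | m <- u]] &
    [seq mask (tval m) w | m <- u] = color_classes k f w.
Proof.
move=> vf wf.
pose m (i : 'I_k) : (size w).-tuple bool := map_tuple (fun x => f x == i) (in_tuple w).
pose u := mktuple m.
have uE i : tnth [tuple of [seq mask (tval m) w | m <- u]] i = color_class f i w.
  by rewrite tnth_map tnth_mktuple /color_class filter_mask.
exists u.
  apply/and3P; split.
  - apply/forallP => i; rewrite uE subseq_color_class /=; exact: vf.
  - apply/forallP => i; apply/forallP => j; apply/implyP => ij; rewrite !uE.
    apply/hasPn => x; rewrite mem_filter => /andP[/eqP fx _] /=; rewrite mem_filter fx.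
    by rewrite eq_sym (inj_eq val_inj) (negbTE ij).
  - by rewrite -wf weight_sum big_mkord; apply/eqP; apply: eq_bigr => i _; rewrite uE.
apply: (@eq_from_nth _ [::]); first by rewrite size_tuple size_map size_iota.
move=> i; rewrite size_tuple => ik.
have := uE (Ordinal ik); rewrite (tnth_nth [::]) /= => ->.
by rewrite (nth_map 0) ?size_iota // nth_iota.
Qed.

Definition top_heads (T : tableau) (k : nat) : seq nat :=
  [seq entry T c 0 | c <- take k (ranked_rows T)].

Lemma max_IES_eq k w : uniq w -> {in w, forall x, 0 < x} -> k <= size (YC_tableau w) ->
  uniq (top_heads (YC_tableau w) k) -> {in top_heads (YC_tableau w) k, forall x, 0 < x} ->
  max_IES k w = [fset x in top_heads (YC_tableau w) k].
Proof.
move=> uw w0 kT ut t0; rewrite /max_IES; have [->|k0] := eqVneq k 0.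
  by rewrite /top_heads take0; apply/fsetP => x; rewrite !inE.
have [f [vf wf hf]] := YC_optimal_coloring uw k.
have maxE : max_k_increasing k w = sumn (take k (ranked_sizes (YC_tableau w))).
  apply: max_k_increasing_eq => //; first by move=> g; exact: YC_weight.
  by exists f.
have cS v : count (leq v) [fset x in top_heads (YC_tableau w) k] =
    count (fun c => maxn v 1 <= entry (YC_tableau w) c 0) (take k (ranked_rows (YC_tableau w))).
  rewrite (seq.permP (perm_fset ut)).
  rewrite -[RHS]/(count (preim (fun c => entry (YC_tableau w) c 0) (leq (maxn v 1))) _).
  rewrite -count_map; apply: eq_in_count => x /t0 x0 /=; by rewrite geq_max x0 andbT.
apply: big_max_set => [m inc|].
  have [g [vg wg ->]] := in_Inc_coloring uw inc.
  apply: le_set_dominated => v; rewrite count_IES // cS.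
  by apply: YC_heads => //; rewrite wg.
have [|u inc e] := coloring_in_Inc vf; first by rewrite maxE.
exists u => //; rewrite e; apply: le_set_anti; apply: le_set_dominated => v;
  by rewrite count_IES // cS hf.
Qed.

(** * Ranks of rows and membership in the maximal sets *)

Section Word.

Variable w : seq nat.
Hypotheses (uw : uniq w) (w0 : {in w, forall x, 0 < x}).
Let T := YC_tableau w.
Let l := size T.

Let ctT : composition_tableau T. Proof. by have [] := YC_tableau_spec uw. Qed.

Lemma entry0_gt0 c : c < l -> 0 < entry T c 0.
Proof.
move=> cl; have [_ _ kT] := YC_tableau_spec uw; apply: w0.
rewrite -(perm_mem (knuth_perm (kT _ (ltnSn _)))); apply: mem_columns_word => //.
exact: ct_cell.
Qed.

Lemma entry0_inj : {in gtn l &, injective (fun c => entry T c 0)}.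
Proof.
move=> a b /= al bl e; case: (ltngtP a b) => // h.
  by have := ct_head ctT h bl; rewrite e ltnn.
by have := ct_head ctT h al; rewrite e ltnn.
Qed.

Lemma max_IES_top_heads k : k <= l -> max_IES k w = [fset x in top_heads T k].
Proof.
have ml c : c \in take k (ranked_rows T) -> c < l by move/mem_take; rewrite mem_ranked_rows.
move=> kl; apply: max_IES_eq => // [|x /mapP[c /ml cl ->]]; last exact: entry0_gt0.
rewrite map_inj_in_uniq ?take_uniq ?uniq_ranked_rows // => a b /ml al /ml bl.
exact: entry0_inj.
Qed.

(** Distinct rows have distinct first entries, so a first entry belongs to the set exactly when its
    row is among the first [k] in rank. Both parts of the theorem are read off from this. *)
Lemma mem_max_IES k c : k <= l -> c < l ->
  (entry T c 0 \in max_IES k w) = (index c (ranked_rows T) < k).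
Proof.
move=> kl cl; rewrite max_IES_top_heads // inE.
have cT : c \in ranked_rows T by rewrite mem_ranked_rows.
rewrite -[RHS](in_take _ cT); apply/mapP/idP => [[b bk e]|ck]; last by exists c.
suff -> : c = b by [].
apply: entry0_inj => //=; last by move/mem_take: bk; rewrite mem_ranked_rows.
Qed.

Lemma sort_max_IES : sort leq (max_IES l w) = [seq entry T c 0 | c <- iota 0 l].
Proof.
have ss : sorted ltn [seq entry T c 0 | c <- iota 0 l].
  apply/(sortedP 0) => i; rewrite size_map size_iota => il.
  rewrite !(nth_map 0) ?size_iota ?(ltnW il) // !nth_iota ?(ltnW il) // !add0n.
  exact: (ct_head ctT).
apply: (sorted_eq leq_trans anti_leq); first exact: (sort_sorted leq_total).
  by apply: sub_sorted ss => a b /ltnW.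
rewrite perm_sort; apply: uniq_perm; rewrite ?fset_uniq //.
  exact: (sorted_uniq ltn_trans ltnn ss).
move=> x; apply/idP/mapP => [|[c]].
  rewrite max_IES_top_heads // inE => /mapP[c /mem_take cT ->].
  by exists c; rewrite // mem_iota /= -mem_ranked_rows.
rewrite mem_iota /= add0n => cl ->; rewrite mem_max_IES //.
by rewrite -[X in _ < X](size_ranked_rows T) index_mem mem_ranked_rows.
Qed.

End Word.

Lemma word_uniq n (s : 'S_n) : uniq (word s).
Proof. by rewrite map_inj_uniq ?enum_uniq // => i j [] /val_inj /perm_inj. Qed.

Lemma word_gt0 n (s : 'S_n) : {in word s, forall x, 0 < x}.
Proof. by move=> x /mapP[i _ ->]. Qed.

Unset Implicit Arguments.

Theorem theorem3p15 (n : nat) (s : 'S_n) :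
  let w := word s in
  let lam := shape (RS_tableau w) in
  let l := size lam in
  let alpha := shape (YC_tableau w) in
  let x := sort leq (max_IES l w) in
  (max_IES 0 w = fset0 /\
   forall k : nat, k < l -> max_IES k w `<` max_IES k.+1 w) /\
  [/\ size alpha = l,
      size x = l
    & forall k : nat, 1 <= k <= l ->
        exists t : nat,
          [/\ 1 <= t <= l,
              nth 0 x k.-1 \in max_IES t w,
              forall t' : nat, 1 <= t' <= l ->
                nth 0 x k.-1 \in max_IES t' w -> t <= t'
            & nth 0 alpha k.-1 = nth 0 lam t.-1]].
Proof.
move=> w lam l alpha x; have uw := word_uniq s; have w0 := @word_gt0 n s.
set T := YC_tableau w in alpha *.
have lamE : lam = ranked_sizes T by exact: RS_shape.
have lE : l = size T by rewrite /l lamE size_map size_ranked_rows.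
have xE : x = [seq entry T c 0 | c <- iota 0 l] by rewrite /x lE; exact: sort_max_IES.
have rl c : (c \in ranked_rows T) = (c < l) by rewrite mem_ranked_rows lE.
have mem k c : k <= l -> c < l -> (entry T c 0 \in max_IES k w) = (index c (ranked_rows T) < k).
  by rewrite lE; exact: mem_max_IES.
split; first split=> // k kl.
  (* The row of rank [k], counted from 0, provides the element that makes the inclusion strict. *)
  have ck : nth 0 (ranked_rows T) k < l by rewrite -rl mem_nth // size_ranked_rows -lE.
  have ik : index (nth 0 (ranked_rows T) k) (ranked_rows T) = k.
    by rewrite index_uniq ?uniq_ranked_rows // size_ranked_rows -lE.
  rewrite fproperE; apply/andP; split; last first.
    apply/negP => /fsubsetP/(_ (entry T (nth 0 (ranked_rows T) k) 0)).
    by rewrite !mem ?ik ?(ltnW kl) // ltnSn ltnn => /(_ isT).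
  apply/fsubsetP => y; rewrite max_IES_top_heads -?lE ?(ltnW kl) // inE => /mapP[c ct ->].
  have cl : c < l by rewrite -rl (mem_take ct).
  rewrite mem // ltnW // ltnS -mem ?(ltnW kl) //.
  by rewrite max_IES_top_heads -?lE ?(ltnW kl) // inE; apply: map_f.
split; first by rewrite size_map lE.
  by rewrite xE size_map size_iota.
move=> k /andP[k0 kl]; have cl : k.-1 < l by rewrite prednK.
have il : index k.-1 (ranked_rows T) < l.
  by rewrite lE -[X in _ < X](size_ranked_rows T) index_mem rl.
rewrite xE (nth_map 0) ?size_iota // nth_iota // add0n.
(* First entries increase upwards, so the [k]-th smallest one belongs to row [k.-1]; it enters the
   sets at its rank plus one, as ranks start at 0. *)
exists (index k.-1 (ranked_rows T)).+1; split=> //.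
- by rewrite mem.
- by move=> t' /andP[_ t'l]; rewrite mem.
rewrite lamE /= (nth_map 0) ?size_ranked_rows -?lE // nth_index ?rl //.
by rewrite (nth_map [::]) // -lE.
Qed.
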